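(* Let $\zeta\in X$ and $b_1,b_2\in\mathbf B$. Then $\omega(b_1\diamondsuit_\zeta b_2)=b_2\diamondsuit_{-\zeta}b_1$ in $\dot{\mathbf U}$.
   Context: $(I,\cdot)$ is a symmetric Cartan datum: a finite set $I$ with a symmetric bilinear form $\mathbb Z[I]\times\mathbb Z[I]\to\mathbb Z$ with $i\cdot i=2$ and $i\cdot j\le 0$ for $i\neq j$. $(Y,X,\langle\,,\rangle,\ldots)$ is a $Y$-regular root datum of type $(I,\cdot)$: finitely generated free abelian groups $Y,X$, a perfect pairing $\langle\,,\rangle:Y\times X\to\mathbb Z$, embeddings $I\hookrightarrow Y$, $I\hookrightarrow X$ with $\langle i,j\rangle=i\cdot j$, the image of $I$ in $Y$ being linearly independent. $X^+=\{\lambda\in X:\langle i,\lambda\rangle\in\mathbb N\ \forall i\in I\}$. $\mathbf f$ is the unital $\mathbb Q(v)$-algebra generated by $\theta_i$ ($i\in I$) with the quantum Serre relations $\sum_{n=0}^{1-i\cdot j}(-1)^n\theta_i^{(n)}\theta_j\theta_i^{(1-i\cdot j-n)}=0$ ($i\ne j$), $\theta_i^{(n)}=\theta_i^n/[n]!$, $[n]=\frac{v^n-v^{-n}}{v-v^{-1}}$; it is $\mathbb N[I]$-graded with $|\theta_i|=i$. $r:\mathbf f\to\mathbf f\otimes\mathbf f$ is the algebra homomorphism with $r(\theta_i)=\theta_i\otimes1+1\otimes\theta_i$ for the product $(x_1\otimes x_2)(y_1\otimes y_2)=v^{|x_2|\cdot|y_1|}x_1y_1\otimes x_2y_2$, and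 $(\,,)_{\mathbf f}$ is the unique nondegenerate symmetric bilinear form with $(1,1)=1$, $(\theta_i,\theta_j)=\delta_{ij}(1-v^{-2})^{-1}$, $(xy,z)=(x\otimes y,r(z))$. $\mathbf B=\bigsqcup_\nu\mathbf B_\nu$ is Lusztig's canonical basis of $\mathbf f$. $\mathbf U$ is the quantum group: generators $E_i,F_i,K_\mu$ ($i\in I,\mu\in Y$), relations $K_0=1$, $K_\mu K_{\mu'}=K_{\mu+\mu'}$, $K_\mu E_i=v^{\langle\mu,i\rangle}E_iK_\mu$, $K_\mu F_i=v^{-\langle\mu,i\rangle}F_iK_\mu$, $E_iF_j-F_jE_i=\delta_{ij}\frac{K_i-K_{-i}}{v-v^{-1}}$ and the quantum Serre relations for the $E_i$ and for the $F_i$. $x\mapsto x^\pm$ are the isomorphisms of $\mathbf f$ onto the subalgebras $\mathbf U^\pm$ with $\theta_i^+=E_i$, $\theta_i^-=F_i$. $\Delta(E_i)=E_i\otimes1+K_i\otimes E_i$, $\Delta(F_i)=1\otimes F_i+F_i\otimes K_{-i}$, $\Delta(K_\mu)=K_\mu\otimes K_\mu$; tensor products are $\mathbf U$-modules via $\Delta$. $\omega$ is the automorphism of $\mathbf U$ with $\omega(E_i)=F_i$, $\omega(F_i)=E_i$, $\omega(K_\mu)=K_{-\mu}$; ${}^\omega M$ is $M$ (elements ${}^\omega m$) with $u({}^\omega m)={}^\omega(\omega(u)m)$. For $\lambda\in X^+$, $\Lambda_\lambda$ is the simple integrable highest weight module with highest weight vector $\eta_\lambda$ (the Verma module modulo $\sum_i\mathbf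 U^-F_i^{\langle i,\lambda\rangle+1}v_\lambda$), ${}^\omega\Lambda_\lambda$ has lowest weight vector $\xi_{-\lambda}={}^\omega\eta_\lambda$; $\mathbf B(\Lambda_\lambda)=\{b^-\eta_\lambda:b\in\mathbf B\}\setminus\{0\}$, $\mathbf B({}^\omega\Lambda_\lambda)=\{b^+\xi_{-\lambda}:b\in\mathbf B\}\setminus\{0\}$ are their canonical bases, and bar-involutions are the $\mathbb Q$-linear involutions with $v\mapsto v^{-1}$ fixing these bases. On ${}^\omega\Lambda_{\lambda_1}\otimes\Lambda_{\lambda_2}$ let $\Psi(m_1\otimes m_2)=\sum_{\nu\in\mathbb N[I]}(-v)^{\mathrm{tr}\,\nu}\sum_{b\in\mathbf B_\nu}b^-\overline{m_1}\otimes b^{*+}\overline{m_2}$ with $\mathrm{tr}\,\nu=\sum_i\nu_i$ and $\{b^*\}$ the basis of $\mathbf f_\nu$ dual to $\mathbf B_\nu$. For $b_1\in\mathbf B({}^\omega\Lambda_{\lambda_1})$, $b_2\in\mathbf B(\Lambda_{\lambda_2})$, $b_1\diamondsuit b_2$ is the unique $\Psi$-invariant element congruent to $b_1\otimes b_2$ modulo $v^{-1}\mathbb Z[v^{-1}]$-combinations of $\mathbf B({}^\omega\Lambda_{\lambda_1})\otimes\mathbf B(\Lambda_{\lambda_2})$. Modified quantum group: $\dot{\mathbf U}=\bigoplus_{\zeta_1,\zeta_2\in X}{}_{\zeta_1}\mathbf U_{\zeta_2}$, ${}_{\zeta_1}\mathbf U_{\zeta_2}=\mathbf U/(\sum_\mu(K_\mu-v^{\langle\mu,\zeta_1\rangle})\mathbf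 U+\sum_\mu\mathbf U(K_\mu-v^{\langle\mu,\zeta_2\rangle}))$, Lusztig's algebra with idempotents $1_\zeta$; $\omega$ induces an algebra automorphism of $\dot{\mathbf U}$, also denoted $\omega$, with $\omega(1_\zeta)=1_{-\zeta}$. ${}_{\mathcal A}\dot{\mathbf U}$ is the $\mathbb Z[v,v^{-1}]$-subalgebra generated by all $E_i^{(n)}1_\zeta$, $F_i^{(n)}1_\zeta$. For $\zeta\in X$, $b_1,b_2\in\mathbf B$, $b_1\diamondsuit_\zeta b_2\in{}_{\mathcal A}\dot{\mathbf U}1_\zeta$ is the unique element with $(b_1\diamondsuit_\zeta b_2)(\xi_{-\lambda_1}\otimes\eta_{\lambda_2})=b_1^+\xi_{-\lambda_1}\diamondsuit b_2^-\eta_{\lambda_2}$ for all $\lambda_1,\lambda_2\in X^+$ with $\lambda_2-\lambda_1=\zeta$ and $b_1^+\xi_{-\lambda_1}\ne0\ne b_2^-\eta_{\lambda_2}$. These elements form Lusztig's canonical basis $\dot{\mathbf B}$ of $\dot{\mathbf U}$. *)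

(* Defs.v *)
From HB Require Import structures.
From mathcomp Require Import all_boot all_order all_algebra.
From mathcomp Require Import boolp classical_sets functions cardinality fsbigop.
From mathcomp Require Import finmap monalg.

Set Implicit Arguments.
Unset Strict Implicit.
Unset Printing Implicit Defensive.

Import GRing.Theory.

Local Open Scope classical_set_scope.
Local Open Scope ring_scope.

(* The unique [x] such that [P x].  Each use below denotes an object that exists
   and is unique by a standard theorem, so the default [x0] is never reached. *)
Definition the (T : Type) (x0 : T) (P : T -> Prop) : T :=
  if pselect (exists! x, P x) is left h then projT1 (cid h) else x0.

Section Span.
Context {K : fieldType} {V : lmodType K}.

Inductive span (S : set V) : set V :=
| span_sub x of S x : span S x
| span0 : span S 0
| span_lin (a : K) x y of span S x & span S y : span S (a *: x + y).

Definition span_pred (S : set V) : {pred V} := fun x => `[< span S x >].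

Lemma spanZ (S : set V) a x : span S x -> span S (a *: x).
Proof. by move=> Sx; rewrite -[_ *: _]addr0; apply: span_lin => //; exact: span0. Qed.

Lemma spanB (S : set V) x y : span S x -> span S y -> span S (x - y).
Proof.
by move=> Sx Sy; rewrite addrC -scaleN1r; exact: span_lin.
Qed.

Lemma span_pred_zmod (S : set V) : zmod_closed (span_pred S).
Proof.
split; first by apply/asboolP; exact: span0.
by move=> x y /asboolP Sx /asboolP Sy; apply/asboolP; exact: spanB.
Qed.

HB.instance Definition _ (S : set V) :=
  GRing.isZmodClosed.Build V (span_pred S) (span_pred_zmod S).

Definition is_basis (B : set V) : Prop :=
  (forall x, span B x) /\
  forall (s : seq V) (c : V -> K), uniq s -> (forall b, b \in s -> B b) ->
    \sum_(b <- s) c b *: b = 0 -> forall b, b \in s -> c b = 0.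

End Span.

Section Quotient.
Context {K : fieldType} {V : lmodType K} (S : set V).

Definition quo_type := Quotient.quot (span_pred S).
HB.instance Definition _ := GRing.Zmodule.on quo_type.

Let qp (x : V) : quo_type := (\pi_(Quotient.quot (span_pred S)) x)%qT.
Let qr (x : quo_type) : V := generic_quotient.repr x.

Let qrK : cancel qr qp.
Proof. by move=> x; rewrite /qp /qr generic_quotient.reprK. Qed.

Let eq_qp x y : qp x = qp y <-> span S (x - y).
Proof.
split=> [/eqP|h].
  by rewrite -[_ == _]Quotient.idealrBE => /asboolP.
apply/eqP; rewrite -[_ == _]Quotient.idealrBE; exact/asboolP.
Qed.

Let qr_qp x : span S (qr (qp x) - x).
Proof. by apply/eq_qp; rewrite qrK. Qed.

Let qpD : {morph qp : x y / x + y}.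
Proof. by move=> x y; rewrite /qp Quotient.pi_add. Qed.

Let qscale (a : K) (x : quo_type) : quo_type := qp (a *: qr x).

Let qscale_qp a x : qscale a (qp x) = qp (a *: x).
Proof. by apply/eq_qp; rewrite -scalerBr; exact/spanZ/qr_qp. Qed.

Fact quo_scalerA a b x : qscale a (qscale b x) = qscale (a * b) x.
Proof. by rewrite -[x]qrK !qscale_qp scalerA. Qed.

Fact quo_scale1r : left_id 1 qscale.
Proof. by move=> x; rewrite -[x]qrK qscale_qp scale1r. Qed.

Fact quo_scalerDr : right_distributive qscale +%R.
Proof. by move=> a x y; rewrite -[x]qrK -[y]qrK -qpD !qscale_qp scalerDr qpD. Qed.

Fact quo_scalerDl x : {morph qscale^~ x : a b / a + b}.
Proof. by move=> a b; rewrite -[x]qrK !qscale_qp scalerDl qpD. Qed.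

HB.instance Definition _ := GRing.Zmodule_isLmodule.Build K quo_type
  quo_scalerA quo_scale1r quo_scalerDr quo_scalerDl.

Definition quo : lmodType K := quo_type.
Definition qpi (x : V) : quo := qp x.
Definition qrepr (x : quo) : V := qr x.

Lemma qreprK : cancel qrepr qpi.
Proof. exact: qrK. Qed.

Lemma eq_qpi x y : qpi x = qpi y <-> span S (x - y).
Proof. exact: eq_qp. Qed.

Lemma qrepr_qpi x : span S (qrepr (qpi x) - x).
Proof. exact: qr_qp. Qed.

Fact qpi_linear : linear qpi.
Proof. by move=> a x y; rewrite /qpi qpD -qscale_qp. Qed.

HB.instance Definition _ := GRing.isLinear.Build K V quo *:%R qpi qpi_linear.

End Quotient.
Global Opaque quo qpi qrepr.

Section AlgebraQuotient.
Context {K : fieldType} {A : algType K}.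

Definition ideal_gens (R : set A) : set A :=
  [set z | exists a r b, R r /\ z = a * r * b].

Context (R : set A).

Lemma ideal_mull a x : span (ideal_gens R) x -> span (ideal_gens R) (a * x).
Proof.
elim=> [_ [b [r [c [Rr ->]]]]||c y z _ IHy _ IHz].
- by apply: span_sub; exists (a * b), r, c; rewrite !mulrA.
- by rewrite mulr0; exact: span0.
- by rewrite mulrDr -scalerAr; exact: span_lin.
Qed.

Lemma ideal_mulr a x : span (ideal_gens R) x -> span (ideal_gens R) (x * a).
Proof.
elim=> [_ [b [r [c [Rr ->]]]]||c y z _ IHy _ IHz].
- by apply: span_sub; exists b, r, (c * a); rewrite !mulrA.
- by rewrite mul0r; exact: span0.
- by rewrite mulrDl -scalerAl; exact: span_lin.
Qed.

(* the quotient of [A] by the two-sided ideal generated by [R]; properness is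
   needed because MathComp algebras are nonzero *)
Definition aquo_type (proper : ~ span (ideal_gens R) 1) : Type :=
  quo (ideal_gens R).

Context (proper : ~ span (ideal_gens R) 1).
Local Notation Q := (aquo_type proper).

HB.instance Definition _ := GRing.Lmodule.on Q.

Let ap (x : A) : Q := qpi (ideal_gens R) x.
Let ar (x : Q) : A := qrepr x.
Let apP a x y : ap (a *: x + y) = a *: ap x + ap y.
Proof. exact: linearP. Qed.
Let apD x y : ap (x + y) = ap x + ap y.
Proof. exact: raddfD. Qed.
Let apZ a x : ap (a *: x) = a *: ap x.
Proof. exact: linearZ. Qed.

Let arK : cancel ar ap.
Proof. exact: qreprK. Qed.

Let amul (x y : Q) : Q := ap (ar x * ar y).

Let amul_ap x y : amul (ap x) (ap y) = ap (x * y).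
Proof.
apply/eq_qpi; set x' := ar _; set y' := ar _.
have -> : x' * y' - x * y = (x' - x) * y' + x * (y' - y).
  by rewrite mulrBl mulrBr addrA subrK.
rewrite -[_ * y']scale1r; apply: span_lin.
  by apply: ideal_mulr; exact: qrepr_qpi.
by apply: ideal_mull; exact: qrepr_qpi.
Qed.

Fact aquo_mulA : associative amul.
Proof. by move=> x y z; rewrite -[x]arK -[y]arK -[z]arK !amul_ap mulrA. Qed.

Fact aquo_mul1l : left_id (ap 1) amul.
Proof. by move=> x; rewrite -[x]arK amul_ap mul1r. Qed.

Fact aquo_mul1r : right_id (ap 1) amul.
Proof. by move=> x; rewrite -[x]arK amul_ap mulr1. Qed.

Fact aquo_mulDl : left_distributive amul +%R.
Proof.
move=> x y z; rewrite -[x]arK -[y]arK -[z]arK.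
by rewrite -apD !amul_ap mulrDl apD.
Qed.

Fact aquo_mulDr : right_distributive amul +%R.
Proof.
move=> x y z; rewrite -[x]arK -[y]arK -[z]arK.
by rewrite -apD !amul_ap mulrDr apD.
Qed.

Fact aquo_1neq0 : ap 1 != 0.
Proof.
apply/eqP; have <- : ap 0 = 0 by exact: raddf0.
by move=> /eq_qpi; rewrite subr0; exact: proper.
Qed.

HB.instance Definition _ := GRing.Zmodule_isNzRing.Build Q
  aquo_mulA aquo_mul1l aquo_mul1r aquo_mulDl aquo_mulDr aquo_1neq0.

Let apM x y : ap (x * y) = ap x * ap y.
Proof. exact/esym/amul_ap. Qed.

Fact aquo_scalerAl (a : K) (x y : Q) : a *: (x * y) = (a *: x) * y.
Proof. by rewrite -[x]arK -[y]arK -apM -!apZ -apM scalerAl. Qed.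

HB.instance Definition _ := GRing.Lmodule_isLalgebra.Build K Q aquo_scalerAl.

Fact aquo_scalerAr (a : K) (x y : Q) : a *: (x * y) = x * (a *: y).
Proof. by rewrite -[x]arK -[y]arK -apM -!apZ -apM scalerAr. Qed.

HB.instance Definition _ := GRing.Lalgebra_isAlgebra.Build K Q aquo_scalerAr.

Definition aquo : algType K := Q.
Definition api (x : A) : aquo := ap x.
Definition arepr (x : aquo) : A := ar x.

Lemma areprK : cancel arepr api.
Proof. exact: arK. Qed.

Lemma eq_api x y : api x = api y <-> span (ideal_gens R) (x - y).
Proof. exact: eq_qpi. Qed.

Fact api_linear : linear api.
Proof. exact: apP. Qed.

Fact api_monoid : monoid_morphism api.
Proof. by split=> // x y; exact: apM. Qed.

HB.instance Definition _ := GRing.isLinear.Build K A aquo *:%R api api_linear.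
HB.instance Definition _ := GRing.isMonoidMorphism.Build A aquo api api_monoid.

End AlgebraQuotient.
Global Opaque aquo api arepr.

Section FreeAlgebra.
Context (K : fieldType) (G : choiceType).

Definition free_alg_type := {malg K[{fmonom G}]}.
HB.instance Definition _ := GRing.Lalgebra.on free_alg_type.

Fact free_alg_scalerAr (a : K) (x y : free_alg_type) :
  a *: (x * y) = x * (a *: y).
Proof.
have mulC (c : K) (g : free_alg_type) : g * (c%:MP : {malg K[{fmonom G}]}) = c *: g.
  rewrite -[LHS]/(fgmul g _) -[RHS]/(fgscale c g) fgmulgU /fgscale.
  by apply: eq_bigr => k _; rewrite mulm1 mulrC.
by rewrite -!mulC mulrA.
Qed.

HB.instance Definition _ :=
  GRing.Lalgebra_isAlgebra.Build K free_alg_type free_alg_scalerAr.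

Definition free_alg : algType K := free_alg_type.

Definition gen (g : G) : free_alg := << fmu g >>.

(* the algebra morphism sending each generator [g] to [h g] *)
Definition free_lift (A : algType K) (h : G -> A) (x : free_alg) : A :=
  mmap (in_alg A) (fun w : {fmonom G} => \prod_(g <- w) h g) x.

(* The character of the free algebra that is 1 on the generators in [p] and 0
   on the others; it witnesses properness of the defining ideals below. *)
Section Character.
Context (p : pred G).

Definition char_mon (w : {fmonom G}) : K := (all p w)%:R.

Fact char_mon_mmorphism : mmorphism char_mon.
Proof.
split=> [x y|]; rewrite /char_mon; last by rewrite fm1.
by rewrite fmM all_cat; case: (all _ _); case: (all _ _); rewrite ?mulr1 ?mulr0.
Qed.

HB.instance Definition _ :=
  isMultiplicative.Build {fmonom G} K char_mon char_mon_mmorphism.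

Definition free_char : free_alg -> K := mmap idfun char_mon.
HB.instance Definition _ := GRing.isZmodMorphism.Build free_alg K free_char
  (raddfB (mmap idfun char_mon)).

Fact free_char_monoid : monoid_morphism free_char.
Proof.
split; first exact: (rmorph1 (mmap idfun char_mon)).
exact: (rmorphM (mmap idfun char_mon)).
Qed.

HB.instance Definition _ :=
  GRing.isMonoidMorphism.Build free_alg K free_char free_char_monoid.

Lemma free_char_gen g : free_char (gen g) = (p g)%:R.
Proof. by rewrite /free_char /gen mmapU mul1r /char_mon fmU /= andbT. Qed.

Lemma free_charP a x y : free_char (a *: x + y) = a * free_char x + free_char y.
Proof. by rewrite /free_char raddfD /= mmapZ. Qed.

Lemma proper_ideal (R : set free_alg) :
  (forall r, R r -> free_char r = 0) -> ~ span (ideal_gens R) 1.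
Proof.
move=> R0 I1; have I0 x : span (ideal_gens R) x -> free_char x = 0.
  elim=> [_ [a [r [b [/R0 r0 ->]]]]||a y z _ y0 _ z0].
  - by rewrite !(rmorphM free_char) /= r0 mulr0 mul0r.
  - exact: (rmorph0 free_char).
  - by rewrite free_charP y0 z0 mulr0 addr0.
by move: (I0 _ I1) (oner_neq0 K); rewrite (rmorph1 free_char) => ->; rewrite eqxx.
Qed.

End Character.
End FreeAlgebra.
Arguments gen {K G} g.
Arguments free_char K {G} p x.

Global Opaque free_alg gen.

Section Tensor.
Context {K : fieldType}.

Section Def.
Context (M N : lmodType K).
Local Notation F := {malg K[(M * N)%type]}.

Definition tens_rel : set F := [set t : F |
  (exists a m m' n, t = << (a *: m + m', n) >> - a *: << (m, n) >> - << (m', n) >>)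
  \/
  (exists a m n n', t = << (m, a *: n + n') >> - a *: << (m, n) >> - << (m, n') >>)].

Definition tens : lmodType K := quo tens_rel.

Definition pure (m : M) (n : N) : tens := qpi tens_rel << (m, n) >>.

Lemma pure_linear_l n : linear (pure^~ n).
Proof.
move=> a m m'; rewrite /pure -linearP; apply/eq_qpi/span_sub; left.
by exists a, m, m', n; rewrite opprD addrA.
Qed.

Lemma pure_linear_r m : linear (pure m).
Proof.
move=> a n n'; rewrite /pure -linearP; apply/eq_qpi/span_sub; right.
by exists a, m, n, n'; rewrite opprD addrA.
Qed.

End Def.

Section Lift.
Context (M N P : lmodType K) (f : M -> N -> P).

Let pre_lift (t : {malg K[(M * N)%type]}) : P :=
  \sum_(p <- msupp t) t@_p *: f p.1 p.2.

(* the linear map with [m (x) n |-> f m n], for [f] bilinear *)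
Definition tlift (t : tens M N) : P := pre_lift (qrepr t).

Hypothesis fl : forall n, linear (f^~ n).
Hypothesis fr : forall m, linear (f m).

Let pre_liftEw (d : {fset (M * N)%type}) (t : {malg K[(M * N)%type]}) :
  (msupp t `<=` d)%fset -> pre_lift t = \sum_(p <- d) t@_p *: f p.1 p.2.
Proof.
move=> le; rewrite /pre_lift [LHS](big_fset_incl _ le) //= => x _ /mcoeff_outdom ->.
by rewrite scale0r.
Qed.

Let pre_lift_lin a t u : pre_lift (a *: t + u) = a *: pre_lift t + pre_lift u.
Proof.
set d := (msupp t `|` msupp u)%fset.
have td : (msupp t `<=` d)%fset by exact: fsubsetUl.
have ud : (msupp u `<=` d)%fset by exact: fsubsetUr.
have ad : (msupp (a *: t + u) `<=` d)%fset.
  apply: fsubset_trans (msuppD_le _ _) _; apply: fsetSU; exact: msuppZ_le.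
rewrite (pre_liftEw td) (pre_liftEw ud) (pre_liftEw ad) scaler_sumr -big_split.
by apply: eq_bigr => p _ /=; rewrite mcoeffD mcoeffZ scalerDl scalerA.
Qed.

Let pre_liftU p : pre_lift << p >> = f p.1 p.2.
Proof. by rewrite (pre_liftEw msuppU_le) big_seq_fset1 mcoeffUU scale1r. Qed.

Let pre_liftB t u : pre_lift (t - u) = pre_lift t - pre_lift u.
Proof. by rewrite -[- u]scaleN1r [t + _]addrC pre_lift_lin scaleN1r addrC. Qed.

Let pre_lift0 : pre_lift 0 = 0.
Proof. by rewrite -(subrr 0) pre_liftB subrr. Qed.

Let pre_liftZ a t : pre_lift (a *: t) = a *: pre_lift t.
Proof. by rewrite -[a *: t]addr0 pre_lift_lin pre_lift0 addr0. Qed.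

Let tlift_qpi t : tlift (qpi _ t) = pre_lift t.
Proof.
apply/eqP; rewrite -subr_eq0 -pre_liftB; apply/eqP.
elim: (@qrepr_qpi _ _ (@tens_rel M N) t) => [x||a x y _ x0 _ y0].
- by case=> [[a [m [m' [n ->]]]]|[a [m [n [n' ->]]]]];
    rewrite !pre_liftB pre_liftZ !pre_liftU /= ?fl ?fr addrAC addrK subrr.
- exact: pre_lift0.
- by rewrite pre_lift_lin x0 y0 scaler0 addr0.
Qed.

Lemma tlift_pure m n : tlift (pure m n) = f m n.
Proof. by rewrite tlift_qpi pre_liftU. Qed.

Lemma tlift_linear : linear tlift.
Proof.
move=> a t u; rewrite -[t]qreprK -[u]qreprK !tlift_qpi -pre_lift_lin -tlift_qpi.
by rewrite linearP.
Qed.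

End Lift.

(* the action of [A (x) B] on [M (x) N] induced by operators [a] and [b] *)
Definition tens_act (A B M N : lmodType K) (a : A -> M -> M) (b : B -> N -> N)
    (t : tens A B) (w : tens M N) : tens M N :=
  tlift (fun x y => tlift (fun m n => pure (a x m) (b y n)) w) t.

Definition tens_mul (A B : algType K) (t u : tens A B) : tens A B :=
  tens_act *%R *%R t u.

Definition tens_form (M N : lmodType K) (bM : M -> M -> K) (bN : N -> N -> K)
    (t u : tens M N) : K :=
  tlift (fun x y => tlift (fun m n => bM x m * bN y n : K^o) u : K^o) t.

End Tensor.

Definition Qv : fieldType := {fraction {poly rat}}.
Definition v : Qv := tofrac ('X : {poly rat}).

(* the field automorphism v |-> v^-1, computed on a numerator and a denominator *)
Definition barQ (x : Qv) : Qv :=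
  let ev (p : {poly rat}) : Qv := (map_poly (fun c => tofrac c%:P) p).[v^-1] in
  ev (\n_(generic_quotient.repr x))%qT / ev (\d_(generic_quotient.repr x))%qT.

(* Z[v,v^-1], v^-1 Z[v^-1] and v^-1 Q[[v^-1]] inside Q(v); the last consists of
   the rational functions of negative degree *)
Definition laurentZ : set Qv :=
  [set x | exists (p : {poly int}) (n : nat), x = (map_poly intr p).[v] / v ^+ n].
Definition vinvZ : set Qv :=
  [set x | exists p : {poly int}, x = v^-1 * (map_poly intr p).[v^-1]].
Definition vinv_small : set Qv :=
  [set x | exists p q : {poly rat},
     (size p < size q)%N /\ x = tofrac p / tofrac q].

(* keeps unification from unfolding the fraction field *)
Global Opaque Qv v barQ.

Definition qint (n : nat) : Qv := (v ^+ n - v ^- n) / (v - v^-1).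
Definition qfact (n : nat) : Qv := \prod_(1 <= k < n.+1) qint k.
Definition dpow {A : algType Qv} (x : A) (n : nat) : A := (qfact n)^-1 *: x ^+ n.

Definition semilinear {M : lmodType Qv} (h : M -> M) : Prop :=
  zmod_morphism h /\ forall (c : Qv) m, h (c *: m) = barQ c *: h m.

(* the Z[v,v^-1]-span of [S] closed under the product [mul] *)
Inductive Zv_subalg {A : lmodType Qv} (mul : A -> A -> A) (S : set A) : set A :=
| Zv_gen x of S x : Zv_subalg mul S x
| Zv_0 : Zv_subalg mul S 0
| Zv_lin c x y of laurentZ c & Zv_subalg mul S x & Zv_subalg mul S y :
    Zv_subalg mul S (c *: x + y)
| Zv_mul x y of Zv_subalg mul S x & Zv_subalg mul S y :
    Zv_subalg mul S (mul x y).

(* [cdot] gives the values of the symmetric form on the basis [I] of Z[I] *)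
Record cartan_datum (I : finType) := CartanDatum {
  cdot :> I -> I -> int;
  cdot_sym : forall i j, cdot i j = cdot j i;
  cdot_diag : forall i, cdot i i = 2;
  cdot_le0 : forall i j, i != j -> (cdot i j <= 0)%R }.

Definition fg_free (L : zmodType) : Prop :=
  exists (n : nat) (h : L -> 'rV[int]_n), zmod_morphism h /\ bijective h.

Record root_datum (I : finType) (C : cartan_datum I) := RootDatum {
  Yl : zmodType;
  Xl : zmodType;
  pairing : Yl -> Xl -> int;
  iY : I -> Yl;
  iX : I -> Xl;
  Yl_free : fg_free Yl;
  Xl_free : fg_free Xl;
  pairing_additive_l : forall x, zmod_morphism (pairing^~ x);
  pairing_additive_r : forall y, zmod_morphism (pairing y);
  pairing_perfect_l : forall h : Yl -> int, zmod_morphism h ->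
    exists! x, forall y, pairing y x = h y;
  pairing_perfect_r : forall h : Xl -> int, zmod_morphism h ->
    exists! y, forall x, pairing y x = h x;
  iY_inj : injective iY;
  iX_inj : injective iX;
  pairing_iYX : forall i j, pairing (iY i) (iX j) = C i j;
  Y_regular : forall c : I -> int,
    \sum_i iY i *~ c i = 0 -> forall i, c i = 0 }.

Definition Serre (I : finType) (C : cartan_datum I) (A : algType Qv)
    (x : I -> A) (i j : I) : A :=
  let m := `|1 - C i j|%N in
  \sum_(n < m.+1) (-1) ^+ n *: (dpow (x i) n * x j * dpow (x i) (m - n)).

Lemma Serre_char (I : finType) (C : cartan_datum I) (G : choiceType) (p : pred G)
    (x : I -> G) i j :
  ~~ p (x j) -> free_char Qv p (Serre C (fun k => gen (x k)) i j) = 0.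
Proof.
move=> /negbTE px; rewrite /Serre.
have charM := rmorphM (free_char Qv p).
elim/big_rec: _ => [|n y _ y0]; first exact: (rmorph0 (free_char Qv p)).
by rewrite free_charP y0 !charM /= free_char_gen px mulr0 mul0r mulr0 addr0.
Qed.

Section AlgebraF.
Context {I : finType} (C : cartan_datum I).

Inductive f_rel : set (free_alg Qv I) :=
| f_Serre i j of i != j : f_rel (Serre C gen i j).

Lemma f_proper : ~ span (ideal_gens f_rel) 1.
Proof. by apply: (@proper_ideal _ _ pred0) => _ [i j _]; exact: Serre_char. Qed.

Definition f : algType Qv := aquo f_proper.
Definition f_pi : free_alg Qv I -> f := api f_proper.
Definition f_repr : f -> free_alg Qv I := @arepr _ _ _ f_proper.

Definition theta (i : I) : f := f_pi (gen i).

(* N[I] and its form and trace *)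
Definition NI := {ffun I -> nat}.
Definition NIdot (mu nu : NI) : int :=
  \sum_i \sum_j (mu i)%:Z * (nu j)%:Z * C i j.
Definition NItr (nu : NI) : nat := (\sum_i nu i)%N.

Definition fhom (nu : NI) : set f := span
  [set x | exists2 w : seq I, nu = [ffun i => count_mem i w]
                            & x = \prod_(i <- w) theta i].

(* (x1 (x) x2)(y1 (x) y2) = v^(|x2|.|y1|) x1 y1 (x) x2 y2 *)
Definition is_twisted_mul (mul : tens f f -> tens f f -> tens f f) : Prop :=
  [/\ forall t, linear (mul t), forall t, linear (mul^~ t) &
      forall nu mu x1 x2 y1 y2, fhom nu x2 -> fhom mu y1 ->
        mul (pure x1 x2) (pure y1 y2) =
        v ^ NIdot nu mu *: pure (x1 * y1) (x2 * y2)].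
Definition twisted_mul := the (fun _ _ => 0) is_twisted_mul.

Definition is_fcoprod (r : f -> tens f f) : Prop :=
  [/\ linear r, r 1 = pure 1 1, forall x y, r (x * y) = twisted_mul (r x) (r y) &
      forall i, r (theta i) = pure (theta i) 1 + pure 1 (theta i)].
Definition fcoprod := the (fun _ => 0) is_fcoprod.

Definition is_fform (b : f -> f -> Qv) : Prop :=
  [/\ forall x, linear (b x : f -> Qv^o),
      forall x y, b x y = b y x,
      forall x, (forall y, b x y = 0) -> x = 0,
      b 1 1 = 1 &
      (forall i j, b (theta i) (theta j) =
         if i == j then (1 - v ^- 2)^-1 else 0) /\
      (forall x y z, b (x * y) z = tens_form b b (pure x y) (fcoprod z))].
Definition fform := the (fun _ _ => 0) is_fform.

Definition fbar : f -> f := the id (fun h =>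
  [/\ semilinear h, monoid_morphism h & forall i, h (theta i) = theta i]).

Definition f_int : set f := Zv_subalg *%R
  [set x | x = 1 \/ exists i n, x = dpow (theta i) n].

(* Lusztig's signed canonical basis: the union of B and -B *)
Definition signed_canonical : set f := [set x |
  [/\ (exists nu, fhom nu x), f_int x, fbar x = x & vinv_small (fform x x - 1)]].

Definition theta_mul (i : I) (n : nat) : set f :=
  [set x | exists y, x = theta i ^+ n * y].

Definition signed_canonical_at (i : I) (n : nat) : set f :=
  [set x | [/\ signed_canonical x, theta_mul i n x & ~ theta_mul i n.+1 x]].

(* Lusztig's canonical basis (Introduction to Quantum Groups, 14.2-14.4): the
   basis of f contained in the signed canonical basis, containing 1, and stable
   under the bijections sending b in signed_canonical_at i 0 to the unique b' in
   signed_canonical_at i n congruent to theta_i^(n) b modulo theta_i^(n+1) f. *)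
Definition is_canonical_basis (B : set f) : Prop :=
  [/\ is_basis B, B `<=` signed_canonical, B 1 &
      forall i n b b', (0 < n)%N -> B b -> ~ theta_mul i 1 b ->
        signed_canonical_at i n b' ->
        theta_mul i n.+1 (dpow (theta i) n * b - b') -> B b'].
Definition canonical_basis : set f := the set0 is_canonical_basis.

Local Notation B := canonical_basis.

(* the element b* of the basis of f_nu dual to B_nu *)
Definition dual_canonical (nu : NI) (b : f) : f := the 0 (fun x =>
  fhom nu x /\
  forall b', B b' -> fhom nu b' -> fform x b' = if b' == b then 1 else 0).

End AlgebraF.

Section QuantumGroup.
Context {I : finType} {C : cartan_datum I} (D : root_datum C).
Local Notation Y := (Yl D).
Local Notation X := (Xl D).
Local Notation f := (f C).
Local Notation B := (@canonical_basis I C).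

Definition Ugen := (I + I + Y)%type.
Definition gE (i : I) : free_alg Qv Ugen := gen (inl (inl i)).
Definition gF (i : I) : free_alg Qv Ugen := gen (inl (inr i)).
Definition gK (mu : Y) : free_alg Qv Ugen := gen (inr mu).

Inductive U_rel : set (free_alg Qv Ugen) :=
| U_K0 : U_rel (gK 0 - 1)
| U_KD mu nu : U_rel (gK (mu + nu) - gK mu * gK nu)
| U_KE mu i : U_rel (gK mu * gE i - v ^ (pairing mu (iX D i)) *: (gE i * gK mu))
| U_KF mu i : U_rel (gK mu * gF i - v ^ (- pairing mu (iX D i)) *: (gF i * gK mu))
| U_EF i j : U_rel (gE i * gF j - gF j * gE i -
    if i == j then (v - v^-1)^-1 *: (gK (iY D i) - gK (- iY D i)) else 0)
| U_SerreE i j of i != j : U_rel (Serre C gE i j)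
| U_SerreF i j of i != j : U_rel (Serre C gF i j).

Lemma U_proper : ~ span (ideal_gens U_rel) 1.
Proof.
pose p (g : Ugen) := if g is inr _ then true else false.
apply: (@proper_ideal _ _ p) => x.
have charB := rmorphB (free_char Qv p); have charM := rmorphM (free_char Qv p).
have charZ a y : free_char Qv p (a *: y) = a * free_char Qv p y.
  by rewrite -[a *: y]addr0 free_charP (rmorph0 (free_char Qv p)) addr0.
have char1 := rmorph1 (free_char Qv p).
case=> [|mu nu|mu i|mu i|i j|i j _|i j _]; rewrite ?charB /gE /gF /gK /=.
- by rewrite free_char_gen char1 subrr.
- by rewrite charM /= 3!free_char_gen mulr1 subrr.
- rewrite charZ [X in X - _]charM /= charM /= 2!free_char_gen /=.
  by rewrite mul0r 2!mulr0 subrr.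
- rewrite charZ [X in X - _]charM /= charM /= 2!free_char_gen /=.
  by rewrite mul0r 2!mulr0 subrr.
- rewrite [X in X - _ - _]charM [X in _ - X - _]charM /= 2!free_char_gen /=.
  rewrite mul0r subrr sub0r.
  case: eqP => _; last by rewrite (rmorph0 (free_char Qv p)) oppr0.
  by rewrite charZ charB /= 2!free_char_gen subrr mulr0 oppr0.
- exact: (@Serre_char _ _ _ p (fun k => inl (inl k))).
- exact: (@Serre_char _ _ _ p (fun k => inl (inr k))).
Qed.

Definition U : algType Qv := aquo U_proper.
Definition U_pi : free_alg Qv Ugen -> U := api U_proper.
Definition U_repr : U -> free_alg Qv Ugen := @arepr _ _ _ U_proper.

Definition UE (i : I) : U := U_pi (gE i).
Definition UF (i : I) : U := U_pi (gF i).
Definition UK (mu : Y) : U := U_pi (gK mu).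

(* The maps below are the algebra morphisms with the given values on generators,
   evaluated on a representative in the free algebra. *)
Definition fplus (x : f) : U := free_lift UE (f_repr x).
Definition fminus (x : f) : U := free_lift UF (f_repr x).
Definition omega (u : U) : U :=
  free_lift (fun g : Ugen => match g with
                             | inl (inl i) => UF i
                             | inl (inr i) => UE i
                             | inr mu => UK (- mu)
                             end) (U_repr u).

Definition is_coproduct (d : U -> tens U U) : Prop :=
  [/\ linear d, d 1 = pure 1 1, forall x y, d (x * y) = tens_mul (d x) (d y),
      forall i, d (UE i) = pure (UE i) 1 + pure (UK (iY D i)) (UE i) &
      (forall i, d (UF i) = pure 1 (UF i) + pure (UF i) (UK (- iY D i))) /\
      (forall mu, d (UK mu) = pure (UK mu) (UK mu))].
Definition Delta : U -> tens U U := the (fun _ => 0) is_coproduct.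

(* A U-module is given by a Q(v)-vector space together with its action map. *)
Definition act_omega (M : Type) (a : U -> M -> M) : U -> M -> M :=
  fun u m => a (omega u) m.

Definition act_tens (M N : lmodType Qv) (a : U -> M -> M) (b : U -> N -> N) :
  U -> tens M N -> tens M N := fun u w => tens_act a b (Delta u) w.

Definition dominant (lam : X) : Prop := forall i, (0 <= pairing (iY D i) lam)%R.

(* The left ideal generated by the first two families defines the Verma module
   of highest weight [lam]; the last family then generates the submodule
   \sum_i U^- F_i^(<i,lam>+1) v_lam, since E_j kills F_i^(<i,lam>+1) v_lam. *)
Inductive Lam_rel (lam : X) : set U :=
| Lam_E i : Lam_rel lam (UE i)
| Lam_K mu : Lam_rel lam (UK mu - (v ^ pairing mu lam)%:A)
| Lam_F i : Lam_rel lam (UF i ^+ (`|pairing (iY D i) lam|%N).+1).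

Definition left_ideal_gens (R : set U) : set U :=
  [set x | exists u r, R r /\ x = u * r].

Definition Lam (lam : X) : lmodType Qv := quo (left_ideal_gens (Lam_rel lam)).

Definition act_Lam (lam : X) (u : U) (m : Lam lam) : Lam lam :=
  qpi _ (u * qrepr m).
Definition eta (lam : X) : Lam lam := qpi _ 1.

(* ^omega Lambda_lam has the same underlying vector space as Lambda_lam *)
Definition oLam (lam : X) : lmodType Qv := Lam lam.

Definition act_oLam (lam : X) : U -> oLam lam -> oLam lam :=
  act_omega (@act_Lam lam).
Definition xi (lam : X) : oLam lam := eta lam.

Definition BLam (lam : X) : set (Lam lam) :=
  [set m | m <> 0 /\ exists2 b, B b & m = act_Lam (fminus b) (eta lam)].
Definition BoLam (lam : X) : set (oLam lam) :=
  [set m | m <> 0 /\ exists2 b, B b & m = act_oLam (fplus b) (xi lam)].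

(* the bar involution of a module with canonical basis [S] *)
Definition bar_fixing (M : lmodType Qv) (S : set M) : M -> M := the id (fun h =>
  [/\ semilinear h, involutive h & forall b, S b -> h b = b]).

Section TensorBasis.
Context (lam1 lam2 : X).
Local Notation M := (tens (oLam lam1) (Lam lam2)).

Definition act_M : U -> M -> M := act_tens (@act_oLam lam1) (@act_Lam lam2).

Definition is_Psi (P : M -> M) : Prop :=
  zmod_morphism P /\
  forall m1 m2, P (pure m1 m2) =
    \sum_(nu \in [set: @NI I]) (- v) ^+ NItr nu *:
      \sum_(b \in B `&` fhom nu)
        pure (act_oLam (fminus b) (bar_fixing (@BoLam lam1) m1))
             (act_Lam (fplus (dual_canonical nu b)) (bar_fixing (@BLam lam2) m2)).
Definition Psi : M -> M := the (fun _ => 0) is_Psi.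

(* the v^-1 Z[v^-1]-combinations of B(^omega Lambda_lam1) (x) B(Lambda_lam2) *)
Definition vinvZ_comb : set M := [set w |
  exists s : seq (Qv * (oLam lam1 * Lam lam2)),
    (forall p, p \in s -> [/\ vinvZ p.1, BoLam p.2.1 & BLam p.2.2]) /\
    w = \sum_(p <- s) p.1 *: pure p.2.1 p.2.2].

Definition diamond_mod (b1 : oLam lam1) (b2 : Lam lam2) : M := the 0 (fun w =>
  Psi w = w /\ vinvZ_comb (w - pure b1 b2)).

End TensorBasis.

(* the summand _{z1}U_{z2} *)
Definition Uz_rel (z1 z2 : X) : set U := [set x | exists mu u,
  x = (UK mu - (v ^ pairing mu z1)%:A) * u \/
  x = u * (UK mu - (v ^ pairing mu z2)%:A)].
Definition Uz (z1 z2 : X) : lmodType Qv := quo (Uz_rel z1 z2).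

Definition Uz_pi z1 z2 (u : U) : Uz z1 z2 := qpi _ u.

(* [u] is homogeneous of X-degree [z] *)
Definition Uhom (z : X) (u : U) : Prop :=
  forall mu, UK mu * u = v ^ pairing mu z *: (u * UK mu).

(* a representative of [x] that is homogeneous of degree z1 - z2; the product of
   the modified quantum group and its action on modules are induced by those of U
   on such representatives *)
Definition Uz_hrepr z1 z2 (x : Uz z1 z2) : U :=
  xget 0 [set u | Uhom (z1 - z2) u /\ Uz_pi z1 z2 u = x].

(* the direct sum of all _{z1}U_{z2} *)
Definition fin_supp (x : forall z1 z2, Uz z1 z2) : Prop :=
  finite_set [set z : X * X | x z.1 z.2 != 0].

Record Udot : Type := MkUdot {
  Udot_comp : forall z1 z2, Uz z1 z2;
  _ : fin_supp Udot_comp }.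

HB.instance Definition _ := gen_eqMixin Udot.
HB.instance Definition _ := gen_choiceMixin Udot.

Lemma UdotP (x y : Udot) :
  (forall z1 z2, Udot_comp x z1 z2 = Udot_comp y z1 z2) -> x = y.
Proof.
case: x y => [x px] [y py] /= xy; have e : x = y.
  by do 2![apply: functional_extensionality_dep => ?]; exact: xy.
by case: _ / e py => py; congr MkUdot; exact: Prop_irrelevance.
Qed.

Fact fin_supp0 : fin_supp (fun z1 z2 => 0).
Proof. by apply: (sub_finite_set _ (finite_set0 _)) => z; rewrite /= eqxx. Qed.

Fact fin_supp_lin (c : Qv) (x y : Udot) :
  fin_supp (fun z1 z2 => c *: Udot_comp x z1 z2 + Udot_comp y z1 z2).
Proof.
case: x y => [x px] [y py] /=; rewrite /fin_supp.
apply: (@sub_finite_set _ _ ([set z | x z.1 z.2 != 0] `|` [set z | y z.1 z.2 != 0])).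
  move=> z /=; case: (eqVneq (x z.1 z.2) 0) => [->|]; last by left.
  by rewrite scaler0 add0r; right.
rewrite finite_setU; split; [exact: px|exact: py].
Qed.

Definition Udot_lin c x y := MkUdot (fin_supp_lin c x y).
Definition Udot0 := MkUdot fin_supp0.

Fact Udot_addA : associative (Udot_lin 1).
Proof. by move=> x y z; apply: UdotP => ? ? /=; rewrite !scale1r addrA. Qed.
Fact Udot_addC : commutative (Udot_lin 1).
Proof. by move=> x y; apply: UdotP => ? ? /=; rewrite !scale1r addrC. Qed.
Fact Udot_add0 : left_id Udot0 (Udot_lin 1).
Proof. by move=> x; apply: UdotP => ? ? /=; rewrite scale1r add0r. Qed.
Fact Udot_addN : left_inverse Udot0 ((Udot_lin (-1))^~ Udot0) (Udot_lin 1).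
Proof.
by move=> x; apply: UdotP => ? ? /=; rewrite scale1r addr0 scaleN1r addNr.
Qed.

HB.instance Definition _ :=
  GRing.isZmodule.Build Udot Udot_addA Udot_addC Udot_add0 Udot_addN.

Lemma Udot_compD x y z1 z2 :
  Udot_comp (x + y) z1 z2 = Udot_comp x z1 z2 + Udot_comp y z1 z2.
Proof. by rewrite -[Udot_comp x z1 z2]scale1r. Qed.

Let scale c x := Udot_lin c x Udot0.
Let Udot_comp_scale c x z1 z2 :
  Udot_comp (scale c x) z1 z2 = c *: Udot_comp x z1 z2.
Proof. exact: addr0. Qed.

Fact Udot_scaleA a b x : scale a (scale b x) = scale (a * b) x.
Proof. by apply: UdotP => ? ?; rewrite !Udot_comp_scale scalerA. Qed.
Fact Udot_scale1 : left_id 1 scale.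
Proof. by move=> x; apply: UdotP => ? ?; rewrite Udot_comp_scale scale1r. Qed.
Fact Udot_scaleDr : right_distributive scale +%R.
Proof.
move=> a x y; apply: UdotP => ? ?.
by rewrite Udot_compD !Udot_comp_scale Udot_compD scalerDr.
Qed.
Fact Udot_scaleDl x : {morph scale^~ x : a b / a + b}.
Proof.
by move=> a b; apply: UdotP => ? ?; rewrite Udot_compD !Udot_comp_scale scalerDl.
Qed.

HB.instance Definition _ := GRing.Zmodule_isLmodule.Build Qv Udot
  Udot_scaleA Udot_scale1 Udot_scaleDr Udot_scaleDl.

(* the element with components [x], which is finitely supported in all uses below *)
Definition Udot_of (x : forall z1 z2, Uz z1 z2) : Udot :=
  if pselect (fin_supp x) is left h then MkUdot h else 0.

Definition Udot_mul (x y : Udot) : Udot := Udot_of (fun z1 z3 =>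
  \sum_(z2 \in [set z2 | Udot_comp x z1 z2 != 0])
     Uz_pi z1 z3 (Uz_hrepr (Udot_comp x z1 z2) * qrepr (Udot_comp y z2 z3))).

(* u 1_z: its components are the classes of [u] in all _{z1}U_z *)
Definition idem (u : U) (z : X) : Udot := Udot_of (fun z1 z2 =>
  if z2 == z then Uz_pi z1 z2 u else 0).

(* 1_z = E_i^(0) 1_z is listed separately for the case of an empty [I] *)
Definition Udot_int : set Udot := Zv_subalg Udot_mul [set x | exists z,
  x = idem 1 z \/
  exists i n, x = idem (dpow (UE i) n) z \/ x = idem (dpow (UF i) n) z].

(* maps the class of [u] in _{z1}U_{z2} to that of [omega u] in _{-z1}U_{-z2} *)
Definition Udot_omega (x : Udot) : Udot := Udot_of (fun z1 z2 =>
  Uz_pi z1 z2 (omega (qrepr (Udot_comp x (- z1) (- z2))))).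

(* the action of [x] on a vector [m] of weight [z] *)
Definition Udot_act (M : lmodType Qv) (a : U -> M -> M)
    (x : Udot) (z : X) (m : M) : M :=
  \sum_(z1 \in [set z1 | Udot_comp x z1 z != 0]) a (Uz_hrepr (Udot_comp x z1 z)) m.

Definition diamond (z : X) (b1 b2 : f) : Udot := the 0 (fun x =>
  (exists2 y, Udot_int y & x = Udot_mul y (idem 1 z)) /\
  forall lam1 lam2, dominant lam1 -> dominant lam2 -> lam2 - lam1 = z ->
    let m1 := act_oLam (fplus b1) (xi lam1) in
    let m2 := act_Lam (fminus b2) (eta lam2) in
    m1 <> 0 -> m2 <> 0 ->
    Udot_act (@act_M lam1 lam2) x z (pure (xi lam1) (eta lam2)) =
      diamond_mod m1 m2).

End QuantumGroup.

(* Main.v *)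
(** Since [(omega (x) omega) Delta] is the opposite of [Delta omega], exchanging the
    tensor factors identifies the twist by [omega] of ^omega Lambda_1 (x) Lambda_2
    with ^omega Lambda_2 (x) Lambda_1.  This flip exchanges the canonical bases of the
    factors, and it intertwines the two maps [Psi] because the canonical element
    [sum_b b (x) b^*] of the symmetric form on [f_nu] is symmetric.  Hence it sends
    [b1 <> b2] to [b2 <> b1], so that [omega (b1 <>_zeta b2)] has the defining property
    of [b2 <>_{-zeta} b1].

    The objects involved are described by [the], with a default value when they do
    not exist uniquely.  Each defining property is transported along a bijection
    matching the default values, so no existence or uniqueness theorem is needed. *)
From HB Require Import structures.
From mathcomp Require Import all_boot all_order all_algebra.
From mathcomp Require Import boolp classical_sets functions cardinality fsbigop.
From mathcomp Require Import finmap monalg.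
Require Import Defs.

Set Implicit Arguments.
Unset Strict Implicit.
Unset Printing Implicit Defensive.

Import Order.TTheory GRing.Theory Num.Theory.

Local Open Scope classical_set_scope.
Local Open Scope ring_scope.

(** The product of [Udot] and its action on modules go through a chosen homogeneous representative
    [Uz_hrepr], and [omega] has no reason to commute with this choice. The technical core is
    therefore independence of the choice. It rests on the weight grading of [U]: a homogeneous
    element of degree z1 - z2 that vanishes in the summand with indices z1, z2 already lies in the
    left ideal generated by the K_mu - v^<mu,z2>. Hence it kills vectors of weight z2, and its
    products vanish as well. The symmetry of the canonical element needs a second grading: B must
    meet f_nu in a finite set that spans f_nu. Since [U] and [f] are given by generators and
    relations, both gradings are read off from families of linear operators: conjugation by K_mu on
    [U], and rescaling of one generator by v on [f]. Their joint eigenvalues separate the degrees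
    because v is not a root of unity and, for [U], because the pairing is perfect. *)

Lemma the_spec (T : Type) (x0 : T) (P : T -> Prop) :
  (exists! x, P x) -> P (the x0 P).
Proof.
by move=> ex; rewrite /the; case: pselect => // e; case: cid => /= x [].
Qed.

Lemma the_unique (T : Type) (x0 x : T) (P : T -> Prop) :
  unique P x -> the x0 P = x.
Proof.
by move=> [Px ux]; apply/esym/ux; apply: the_spec; exists x.
Qed.

Lemma the_default (T : Type) (x0 : T) (P : T -> Prop) :
  ~ (exists! x, P x) -> the x0 P = x0.
Proof. by rewrite /the; case: pselect. Qed.

(* Also valid when the described objects do not exist: both sides are then the
   default values. *)
Lemma the_transport (T T' : Type) (x0 : T) (y0 : T') (P : T -> Prop)
    (Q : T' -> Prop) (g : T -> T') (h : T' -> T) :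
  cancel g h -> cancel h g -> (forall x, P x -> Q (g x)) ->
  (forall y, Q y -> P (h y)) -> g x0 = y0 -> g (the x0 P) = the y0 Q.
Proof.
move=> gK hK PQ QP g0; have [[x [Px ux]]|nP] := pselect (exists! x, P x).
  rewrite (@the_unique _ x0 x P) //; apply/esym/the_unique.
  by split=> [|y /QP /ux ->]; [exact: PQ | rewrite hK].
rewrite (the_default _ nP) the_default // => -[y [Qy uy]]; apply: nP.
by exists (h y); split=> [|x /PQ /uy ->]; [exact: QP | rewrite gK].
Qed.

(** * Linear maps, spans and joint eigenspaces *)

Section LinearFacts.
Context {K : fieldType} {V W : lmodType K} (h : V -> W).
Hypothesis hl : linear h.

Lemma lin0 : h 0 = 0.
Proof. by have := hl (-1) 0 0; rewrite !scaleN1r oppr0 addr0 addNr. Qed.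
Lemma linZ a x : h (a *: x) = a *: h x.
Proof. by have := hl a x 0; rewrite lin0 !addr0. Qed.
Lemma linD x y : h (x + y) = h x + h y.
Proof. by have := hl 1 x y; rewrite !scale1r. Qed.
Lemma linN x : h (- x) = - h x.
Proof. by rewrite -scaleN1r linZ scaleN1r. Qed.
Lemma linB x y : h (x - y) = h x - h y.
Proof. by rewrite linD linN. Qed.
Lemma lin_sum (T : Type) (r : seq T) (P : pred T) F :
  h (\sum_(i <- r | P i) F i) = \sum_(i <- r | P i) h (F i).
Proof. exact: (big_morph h linD lin0). Qed.

Lemma lin_span (S : set V) (S' : set W) :
  (forall x, S x -> span S' (h x)) -> forall x, span S x -> span S' (h x).
Proof.
move=> SS' x; elim=> [y /SS' //||a y z _ Sy _ Sz]; first by rewrite lin0; exact: span0.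
by rewrite hl; exact: span_lin.
Qed.

Lemma lin_span0 (S : set V) :
  (forall x, S x -> h x = 0) -> forall x, span S x -> h x = 0.
Proof.
move=> S0 x; elim=> [y /S0 //||a y z _ y0 _ z0]; first exact: lin0.
by rewrite hl y0 z0 scaler0 addr0.
Qed.

(* Both sides vanish when the support is infinite. *)
Lemma lin_fsum (J : choiceType) (A : set J) (F : J -> V) : injective h ->
  h (\sum_(i \in A) F i) = \sum_(i \in A) h (F i).
Proof.
(* An injective [h] preserves nonzero terms, so both sums run over the same support. *)
move=> hi; rewrite lin_sum; suff -> : finite_support 0 A F = finite_support 0 A (h \o F) by [].
rewrite /finite_support !unlock; congr (fset_set _ : seq J); apply/seteqP.
split=> i /= [Ai Fi]; split=> // e; apply: Fi.
  by apply: hi; rewrite lin0.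
by rewrite e lin0.
Qed.
End LinearFacts.

(** The reindexing is by negation because [omega] negates weights. Both the product of [Udot] and
    its action are sums over an intermediate weight of this kind. *)
Lemma lin_fsumN {K : fieldType} {V W : lmodType K} {Z : zmodType} (h : V -> W)
    (P Q : set Z) (F : Z -> V) (G : Z -> W) : linear h -> injective h ->
  (forall z, P (- z) <-> Q z) -> (forall z, Q z -> h (F (- z)) = G z) ->
  h (\sum_(z \in P) F z) = \sum_(z \in Q) G z.
Proof.
move=> hl hi PQ FG; rewrite (lin_fsum hl) //.
rewrite (reindex_fsbig (fun z => - z) Q); last first.
  split=> [z /PQ //|z z' _ _ /oppr_inj //|z Pz].
  by exists (- z); [apply/PQ; rewrite opprK|rewrite opprK].
by apply: eq_fsbigr => z /set_mem /FG.
Qed.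

Lemma linear_id {K : fieldType} {V : lmodType K} : linear (fun x : V => x).
Proof. by []. Qed.

Lemma linear_comp {K : fieldType} {V W Z : lmodType K} (g : W -> Z) (h : V -> W) :
  linear g -> linear h -> linear (fun x => g (h x)).
Proof. by move=> gl hl a x y; rewrite hl gl. Qed.

(** The combination step when linearity in one argument is proved by induction over another argument
    in which the expression is already linear. *)
Lemma scale_interchange {K : fieldType} {V : lmodType K} (c d : K) (x x' y y' : V) :
  d *: (c *: x + x') + (c *: y + y') = c *: (d *: x + y) + (d *: x' + y').
Proof. by rewrite !scalerDr addrACA !scalerA mulrC. Qed.

Lemma linear_scale {K : fieldType} {V : lmodType K} (c : K) :
  linear (fun x : V => c *: x).
Proof. by move=> a x y; rewrite scalerDr !scalerA mulrC. Qed.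

Lemma linear_sub {K : fieldType} {V W : lmodType K} (g h : V -> W) :
  linear g -> linear h -> linear (fun x => g x - h x).
Proof. by move=> gl hl a x y; rewrite gl hl scalerBr opprD addrACA. Qed.

Lemma eq_lincomb {K : fieldType} {V : lmodType K} (c : K) (x x' y y' : V) :
  x = x' -> y = y' -> c *: x + y = c *: x' + y'.
Proof. by move=> -> ->. Qed.

Section SpanFacts.
Context {K : fieldType} {V : lmodType K}.

Lemma spanD (S : set V) x y : span S x -> span S y -> span S (x + y).
Proof. by move=> Sx Sy; rewrite -[x]scale1r; exact: span_lin. Qed.

Lemma span_sum (S : set V) (T : eqType) (r : seq T) F :
  (forall i, i \in r -> span S (F i)) -> span S (\sum_(i <- r) F i).
Proof.
move=> SF; rewrite big_seq; elim/big_rec: _ => [|i x ir Sx]; first exact: span0.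
by apply: spanD => //; exact: SF.
Qed.

Lemma span_sub_span (S S' : set V) :
  (forall x, S x -> span S' x) -> forall x, span S x -> span S' x.
Proof. exact: (lin_span linear_id). Qed.
Lemma spanBC (S : set V) x y : span S (x - y) -> span S (y - x).
Proof. by move=> Sxy; rewrite -opprB -scaleN1r; exact: spanZ. Qed.
End SpanFacts.

(* The submodules [H d] lie in the joint eigenspaces of the operators [A k], and
   distinct indices have distinct eigencharacters. *)
Section WeightSpaces.
Context {K : fieldType} {V : lmodType K} {k X : Type}.
Context (A : k -> V -> V) (chi : k -> X -> K) (H : X -> set V).
Hypothesis Al : forall i, linear (A i).
Hypothesis HA : forall d x i, H d x -> A i x = chi i d *: x.
Hypothesis chi_sep : forall d e, d <> e -> exists i, chi i d <> chi i e.

Definition off_weight (d : X) : set V := [set x | exists2 e, e <> d & H e x].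

(** [T] is a product of factors [A i - chi i e], one for each weight vector that occurs, with [i]
    separating [e] from [d]. Each factor kills its vector and scales [H d] by a nonzero constant. *)
Lemma weight_filter d x : span (off_weight d) x ->
  exists (T : V -> V) (l : X -> K), [/\ linear T,
    forall e y, H e y -> T y = l e *: y, l d <> 0 & T x = 0].
Proof.
elim=> [y [e ed Hy]||a y z Sy [T1 [l1 [T1l T1H l1d T1y]]] Sz [T2 [l2 [T2l T2H l2d T2z]]]].
- have [i ie] := chi_sep ed.
  exists (fun x => A i x - chi i e *: x), (fun d => chi i d - chi i e).
  split=> [|e' u Hu||].
  + exact: linear_sub (Al i) (linear_scale _).
  + by rewrite (HA _ Hu) scalerBl.
  + by move=> /eqP; rewrite subr_eq0 => /eqP /esym.
  + by rewrite (HA _ Hy) subrr.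
- exists (fun x => x), (fun _ => 1); split=> // [e y _|].
  + by rewrite scale1r.
  + exact/eqP/oner_neq0.
(* On a span of weight vectors [T1] and [T2] commute, since both act by scalars on each [H e]. *)
- have comm u : span (off_weight d) u -> T1 (T2 u) = T2 (T1 u).
    move=> Su; apply/eqP; rewrite -subr_eq0; apply/eqP.
    apply: (lin_span0 (h := fun u => T1 (T2 u) - T2 (T1 u))) Su => [|s [e _ Hs]].
      by apply: linear_sub; exact: linear_comp.
    by rewrite (T2H _ _ Hs) (T1H _ _ Hs) (linZ T1l) (linZ T2l) (T2H _ _ Hs) (T1H _ _ Hs)
               !scalerA mulrC subrr.
  exists (fun u => T1 (T2 u)), (fun e => l1 e * l2 e); split.
  + exact: linear_comp.
  + by move=> e u Hu; rewrite (T2H _ _ Hu) (linZ T1l) (T1H _ _ Hu) scalerA mulrC.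
  + by move=> /eqP; rewrite mulf_eq0 => /orP[] /eqP.
  + by rewrite T2l T1l T2z (lin0 T1l) addr0 comm // T1y (lin0 T2l) scaler0.
Qed.

Lemma weight_disjoint d x : H d x -> span (off_weight d) x -> x = 0.
Proof.
move=> Hx /weight_filter [T [l [Tl TH ld Tx]]].
by move: Tx; rewrite (TH _ _ Hx) => /eqP; rewrite scaler_eq0 => /orP[/eqP|/eqP].
Qed.

Lemma weight_component (S : set V) d x :
  (forall y, S y -> exists e, H e y) -> span S x ->
  exists2 y, span (S `&` H d) y & span (off_weight d) (x - y).
Proof.
move=> SH; elim=> [y Sy||a y z _ [y' Sy' oy] _ [z' Sz' oz]].
- have [e He] := SH _ Sy; have [ed|ed] := pselect (e = d).
    by exists y; [apply: span_sub; split=> //; rewrite -ed|rewrite subrr; exact: span0].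
  by exists 0; [exact: span0|rewrite subr0; apply: span_sub; exists e].
- by exists 0; [exact: span0|rewrite subrr; exact: span0].
- exists (a *: y' + z'); first exact: span_lin.
  by rewrite opprD addrACA -scalerBr; exact: span_lin.
Qed.

Hypothesis H_lin : forall d x, span (H d) x -> H d x.

(** Sorting the generators by weight writes [x] as [y] plus an off-weight part. This part also lies
    in [H d], hence is zero. *)
Lemma weight_span (S : set V) d x :
  (forall y, S y -> exists e, H e y) -> span S x -> H d x -> span (S `&` H d) x.
Proof.
move=> SH Sx Hx; have [y Sy oxy] := weight_component d SH Sx.
suff /eqP : x - y = 0 by rewrite subr_eq0 => /eqP ->.
apply: weight_disjoint oxy; apply/H_lin/spanB; first exact: span_sub.
by apply: span_sub_span Sy => z [_ Hz]; exact: span_sub.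
Qed.

End WeightSpaces.

(** * Free algebras and their quotients *)

Lemma malgU_scale (K : fieldType) (T : choiceType) (c : K) (k : T) :
  << c *g k >> = c *: (<< k >> : {malg K[T]}).
Proof. by apply/malgP => k'; rewrite mcoeffZ !mcoeffU mulr_natr. Qed.

Section FreeLift.
Context {K : fieldType} {G : choiceType}.
Local Notation F := (free_alg K G).

Section Lift.
Context {A : algType K} (h : G -> A).

Let pr (w : {fmonom G}) : A := \prod_(g <- w) h g.

Let pr_mmorphism : mmorphism pr.
Proof.
by split=> [x y|]; rewrite /pr ?fm1 ?big_nil // fmM big_cat.
Qed.

HB.instance Definition _ :=
  isMultiplicative.Build {fmonom G} A pr pr_mmorphism.

Transparent free_alg gen.

Lemma free_lift_linear : linear (free_lift h : F -> A).
Proof.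
move=> a x y; rewrite /free_lift (raddfD (mmap (in_alg A) pr)) /=.
by congr (_ + _); rewrite -[RHS]mulr_algl; exact: mmapZ.
Qed.

Lemma free_liftM (x y : F) : free_lift h (x * y) = free_lift h x * free_lift h y.
Proof.
(* In a noncommutative target, multiplicativity of [mmap] comes from the centrality of scalars. *)
have comm (g : {malg K[{fmonom G}]}) m m' : GRing.comm (in_alg A g@_m) (pr m').
  by rewrite /GRing.comm /= mulr_algl mulr_algr.
have [mulE _] := commr_mmap_is_multiplicative comm; exact: mulE.
Qed.

Lemma free_lift1 : free_lift h (1 : F) = 1.
Proof. exact: (@mmap1 _ _ _ (in_alg A) pr). Qed.

Lemma free_lift_gen g : free_lift h (gen g : F) = h g.
Proof.
rewrite /free_lift /gen mmapU /= scale1r mul1r fmU.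
by rewrite big_seq1.
Qed.

End Lift.

Transparent free_alg gen.
Lemma free_alg_ind (P : F -> Prop) :
  P 1 -> (forall g x, P x -> P (gen g * x)) ->
  (forall a x y, P x -> P y -> P (a *: x + y)) -> forall x, P x.
Proof.
move=> P1 Pg Plin; have P0 : P 0 by have := Plin (-1) _ _ P1 P1; rewrite scaleN1r addNr.
have Pw (w : {fmonom G}) : P (<< w >> : {malg K[{fmonom G}]}).
  case: w; elim=> [|g s IHs].
    suff -> : FMonom [::] = (mone : {fmonom G}) by [].
    by apply/eqP; rewrite fmP fm1.
  suff -> : (<< FMonom (g :: s) >> : F) = gen g * << FMonom s >> by exact: Pg.
  rewrite /gen [RHS]malgM_def fgmulUU mulr1; congr (<< _ >>).
  by apply/eqP; rewrite fmP fmM fmU.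
move=> x; rewrite [x]monalgE; elim/big_rec: _ => [//|w y _ Py].
by rewrite malgU_scale; exact: Plin.
Qed.
Opaque free_alg gen.
End FreeLift.

Lemma free_lift_comp {K : fieldType} {G : choiceType} {A B : algType K} (h : G -> A)
    (g : A -> B) : linear g -> g 1 = 1 -> {morph g : x y / x * y} ->
  forall x, g (free_lift h x) = free_lift (fun i => g (h i)) x.
Proof.
move=> gl g1 gM; apply: free_alg_ind => [|i x IH|a x y IHx IHy].
- by rewrite !free_lift1.
- by rewrite !free_liftM !free_lift_gen gM IH.
- by rewrite !free_lift_linear gl IHx IHy.
Qed.

Section AlgebraQuotientLift.
Context {K : fieldType} {G : choiceType} {R : set (free_alg K G)}.
Context (proper : ~ span (ideal_gens R) 1) {A : algType K} (h : G -> A).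
Hypothesis R0 : forall x, R x -> free_lift h x = 0.
Local Notation rep := (@arepr _ _ _ proper).

(** Two representatives differ by an element of the ideal, which the lift kills as soon as it kills
    the relations. This makes [omega], [fplus] and [fscale] genuine morphisms. *)
Lemma quo_lift_api x : free_lift h (rep (api proper x)) = free_lift h x.
Proof.
apply/eqP; rewrite -subr_eq0 -(linB (free_lift_linear h)); apply/eqP.
apply: (lin_span0 (free_lift_linear h)) ((iffLR (eq_api _ _ _)) (areprK _)).
by move=> _ [a [r [b [/R0 r0 ->]]]]; rewrite !free_liftM r0 mulr0 mul0r.
Qed.

Lemma quo_lift_linear : linear (fun x => free_lift h (rep x)).
Proof.
move=> a x y; rewrite -free_lift_linear -[x in LHS]areprK -[y in LHS]areprK.
by rewrite -linearP quo_lift_api.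
Qed.

Lemma quo_liftM x y :
  free_lift h (rep (x * y)) = free_lift h (rep x) * free_lift h (rep y).
Proof. by rewrite -free_liftM -[x in LHS]areprK -[y in LHS]areprK -rmorphM quo_lift_api. Qed.

Lemma quo_lift1 : free_lift h (rep 1) = 1.
Proof. by rewrite -(rmorph1 (api proper)) quo_lift_api free_lift1. Qed.

Lemma quo_lift_gen g : free_lift h (rep (api proper (gen g))) = h g.
Proof. by rewrite quo_lift_api free_lift_gen. Qed.
End AlgebraQuotientLift.

Lemma aquo_ind {K : fieldType} {G : choiceType} {R : set (free_alg K G)}
    (proper : ~ span (ideal_gens R) 1) (P : aquo proper -> Prop) :
  P 1 -> (forall g x, P x -> P (api proper (gen g) * x)) ->
  (forall a x y, P x -> P y -> P (a *: x + y)) -> forall x, P x.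
Proof.
move=> P1 Pg Pl x; rewrite -[x]areprK; move: (arepr x).
apply: free_alg_ind => [|g y IH|a y z Iy Iz].
- by rewrite rmorph1.
- by rewrite rmorphM; exact: Pg.
- by rewrite linearP; exact: Pl.
Qed.

(** * Tensor products, the flip and induced actions *)

Section TensorFacts.
Context {K : fieldType}.

Lemma tens_ind (M N : lmodType K) (P : tens M N -> Prop) :
  (forall m n, P (pure m n)) -> (forall a x y, P x -> P y -> P (a *: x + y)) ->
  forall t, P t.
Proof.
move=> Pp Pl t; rewrite -[t]qreprK [qrepr t]monalgE.
elim/big_rec: _ => [|p x _ Px].
  by rewrite linear0 -(lin0 (@pure_linear_l K M N 0)); exact: Pp.
by rewrite malgU_scale linearP; apply: Pl => //; case: p => m n; exact: Pp.
Qed.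

Lemma tens_ext (M N P : lmodType K) (g h : tens M N -> P) : linear g -> linear h ->
  (forall m n, g (pure m n) = h (pure m n)) -> forall t, g t = h t.
Proof.
move=> gl hl e; apply: tens_ind => // a x y ex ey.
by rewrite gl hl ex ey.
Qed.

Lemma pureZZ (M N : lmodType K) (a b c : K) (m : M) (n : N) :
  a * b = c -> pure (a *: m) (b *: n) = c *: pure m n.
Proof.
by move=> <-; rewrite (linZ (pure_linear_l _)) (linZ (pure_linear_r _)) scalerA.
Qed.

Definition tswap (M N : lmodType K) : tens M N -> tens N M :=
  tlift (fun m n => pure n m).

Lemma tswap_pure (M N : lmodType K) (m : M) (n : N) : tswap (pure m n) = pure n m.
Proof. by apply: tlift_pure => ? ?; [exact: pure_linear_r|exact: pure_linear_l]. Qed.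

Lemma tswap_linear (M N : lmodType K) : linear (@tswap M N).
Proof. by apply: tlift_linear => ? ?; [exact: pure_linear_r|exact: pure_linear_l]. Qed.

Lemma tswapK (M N : lmodType K) : cancel (@tswap M N) (@tswap N M).
Proof.
apply: tens_ext => [|//|m n]; last by rewrite !tswap_pure.
exact: linear_comp (@tswap_linear _ _) (@tswap_linear _ _).
Qed.

Definition tmap (M N P Q : lmodType K) (g : M -> P) (h : N -> Q) :
  tens M N -> tens P Q := tlift (fun m n => pure (g m) (h n)).

Section Tmap.
Context (M N P Q : lmodType K) (g : M -> P) (h : N -> Q).
Hypotheses (gl : linear g) (hl : linear h).

Lemma tmap_pure m n : tmap g h (pure m n) = pure (g m) (h n).
Proof.
by apply: tlift_pure => w; [exact: linear_comp (pure_linear_l _) gl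
                           |exact: linear_comp (pure_linear_r _) hl].
Qed.

Lemma tmap_linear : linear (tmap g h).
Proof.
by apply: tlift_linear => w; [exact: linear_comp (pure_linear_l _) gl
                             |exact: linear_comp (pure_linear_r _) hl].
Qed.
End Tmap.

Section TensAct.
Context (A B M N : lmodType K) (a : A -> M -> M) (b : B -> N -> N).
Hypotheses (al : forall m, linear (a^~ m)) (ar : forall x, linear (a x)).
Hypotheses (bl : forall n, linear (b^~ n)) (br : forall y, linear (b y)).

Let act1 x y : tens M N -> tens M N := tmap (a x) (b y).

Let act1_linear x y : linear (act1 x y).
Proof. exact: tmap_linear. Qed.

Let act1_pure x y m n : act1 x y (pure m n) = pure (a x m) (b y n).
Proof. exact: tmap_pure. Qed.

Let act1_linear_l w y : linear (fun x => act1 x y w).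
Proof.
move=> c x x'; move: w; apply: tens_ind => [m n|d t u IHt IHu].
  by rewrite !act1_pure al pure_linear_l.
by rewrite 3!(act1_linear _ _ d t u) IHt IHu; exact: scale_interchange.
Qed.

Let act1_linear_r w x : linear (fun y => act1 x y w).
Proof.
move=> c y y'; move: w; apply: tens_ind => [m n|d t u IHt IHu].
  by rewrite !act1_pure bl pure_linear_r.
by rewrite 3!(act1_linear _ _ d t u) IHt IHu; exact: scale_interchange.
Qed.

Lemma tens_act_pure x y w : tens_act a b (pure x y) w = tmap (a x) (b y) w.
Proof. exact: (tlift_pure (act1_linear_l w) (act1_linear_r w)). Qed.

Lemma tens_act_pure2 x y m n :
  tens_act a b (pure x y) (pure m n) = pure (a x m) (b y n).
Proof. by rewrite tens_act_pure; exact: act1_pure. Qed.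

Lemma tens_act_linear_l w : linear (fun t => tens_act a b t w).
Proof. exact: (tlift_linear (act1_linear_l w) (act1_linear_r w)). Qed.

Lemma tens_act_linear_r t : linear (tens_act a b t).
Proof.
move=> c w w'; move: t; apply: tens_ind => [x y|d t u IHt IHu].
  by rewrite !tens_act_pure; exact: act1_linear.
by rewrite 3!(tens_act_linear_l _ d t u) IHt IHu; exact: scale_interchange.
Qed.

End TensAct.

Lemma mul_linear_l (A : algType K) (y : A) : linear (fun x : A => x * y).
Proof. by move=> c x x'; rewrite mulrDl scalerAl. Qed.

Lemma mul_linear_r (A : algType K) (x : A) : linear (fun y : A => x * y).
Proof. by move=> c y y'; rewrite mulrDr scalerAr. Qed.

End TensorFacts.

(** * The weight grading of the quantum group *)

Lemma dpow_morph (A B : algType Qv) (g : A -> B) (x : A) (n : nat) :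
  linear g -> g 1 = 1 -> {morph g : x y / x * y} -> g (dpow x n) = dpow (g x) n.
Proof.
move=> gl g1 gM; rewrite /dpow (linZ gl); congr (_ *: _).
by elim: n => [|n IH]; rewrite ?expr0 // !exprS gM IH.
Qed.

Lemma Serre_morph (I : finType) (C : cartan_datum I) (A B : algType Qv) (g : A -> B)
    (x : I -> A) i j : linear g -> g 1 = 1 -> {morph g : x y / x * y} ->
  g (Serre C x i j) = Serre C (fun k => g (x k)) i j.
Proof.
move=> gl g1 gM; rewrite /Serre (lin_sum gl); apply: eq_bigr => n _.
by rewrite (linZ gl) !gM !(dpow_morph _ _ gl g1 gM).
Qed.

(* Failing conversions between elements of the concrete quotient algebras are very
   slow, so computations are done in an abstract algebra and then instantiated. *)
Section AlgMorphism.
Context {A B : algType Qv} (g : A -> B).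
Hypotheses (gl : linear g) (g1 : g 1 = 1) (gM : {morph g : x y / x * y}).

Lemma morph_sub1 a : g (a - 1) = g a - 1.
Proof. by rewrite (linB gl) g1. Qed.
Lemma morph_subM a b c : g (a - b * c) = g a - g b * g c.
Proof. by rewrite (linB gl) gM. Qed.
Lemma morph_qcomm a b c : g (a * b - c *: (b * a)) = g a * g b - c *: (g b * g a).
Proof. by rewrite (linB gl) (linZ gl) !gM. Qed.
Lemma morph_comm a b c d s (t : bool) :
  g (a * b - b * a - (if t then s *: (c - d) else 0)) =
  g a * g b - g b * g a - (if t then s *: (g c - g d) else 0).
Proof.
rewrite !(linB gl) !gM; case: t; last by rewrite (lin0 gl).
by rewrite (linZ gl) (linB gl).
Qed.
End AlgMorphism.

Section Pairing.
Context {I : finType} {C : cartan_datum I} {D : root_datum C}.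
Implicit Types (mu : Yl D) (x y : Xl D).

Lemma pairing0 mu : pairing mu 0 = 0 :> int.
Proof. by have := @pairing_additive_r _ _ D mu 0 0; rewrite !subrr. Qed.
Lemma pairing0l x : pairing 0 x = 0 :> int.
Proof. by have := @pairing_additive_l _ _ D x 0 0; rewrite !subrr. Qed.
Lemma pairingB mu x y : pairing mu (x - y) = pairing mu x - pairing mu y.
Proof. exact: pairing_additive_r. Qed.
Lemma pairingN mu x : pairing mu (- x) = - pairing mu x.
Proof. by rewrite -sub0r pairingB pairing0 sub0r. Qed.
Lemma pairingD mu x y : pairing mu (x + y) = pairing mu x + pairing mu y.
Proof. by rewrite -[y in LHS]opprK pairingB pairingN opprK. Qed.
Lemma pairingNl mu x : pairing (- mu) x = - pairing mu x.
Proof. by rewrite -sub0r pairing_additive_l pairing0l sub0r. Qed.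

(** Both weights represent the same functional on [Yl D], and perfectness makes the representing
    weight unique. *)
Lemma pairing_sep x y : (forall mu : Yl D, pairing mu x = pairing mu y) -> x = y.
Proof.
move=> xy; have [z [_ uz]] := pairing_perfect_l (@pairing_additive_l _ _ D x).
by rewrite -(uz x) // -(uz y).
Qed.

End Pairing.

Lemma v_neq0 : v != 0.
Proof.
Transparent Qv v.
by rewrite /v tofrac_eq0 polyX_eq0.
Opaque Qv v.
Qed.

Lemma expv_eq1 (n : nat) : v ^+ n = 1 -> n = 0%N.
Proof.
Transparent Qv v.
rewrite /v -tofracXn -tofrac1 => /eqP; rewrite tofrac_eq.
move=> /eqP /(congr1 (fun p : {poly rat} => size p)).
by rewrite size_polyXn size_poly1 => -[].
Opaque Qv v.
Qed.

(** Since v is an indeterminate, it is not a root of unity. This lets the eigenvalues v^<mu,d>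
    determine the integers <mu,d>. *)
Lemma vexpz_inj : injective (fun n : int => v ^ n).
Proof.
move=> m n /= e; wlog le_nm : m n e / n <= m.
  by move=> W; have [/W->|/ltW/W->] := leP n m.
have : v ^ (m - n) = 1.
  by rewrite expfzDr ?v_neq0 // e -expfzDr ?v_neq0 // subrr expr0z.
case: (m - n) (subr_ge0 n m) (subrK n m) => [k|k]; last by rewrite le_nm.
by move=> _ <- /expv_eq1 ->; rewrite add0r.
Qed.

Record qg_relations (I : finType) (C : cartan_datum I) (D : root_datum C)
    (A : algType Qv) (E F : I -> A) (K : Yl D -> A) : Prop := QgRelations {
  rel_K0 : K 0 = 1;
  rel_KD : forall mu nu, K (mu + nu) = K mu * K nu;
  rel_KE : forall mu i, K mu * E i = v ^ pairing mu (iX D i) *: (E i * K mu);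
  rel_KF : forall mu i, K mu * F i = v ^ (- pairing mu (iX D i)) *: (F i * K mu);
  rel_EF : forall i j, E i * F j - F j * E i =
    if i == j then (v - v^-1)^-1 *: (K (iY D i) - K (- iY D i)) else 0;
  rel_SE : forall i j, i != j -> Serre C E i j = 0;
  rel_SF : forall i j, i != j -> Serre C F i j = 0 }.

Section AbstractQuantumGroup.
Context {I : finType} {C : cartan_datum I} {D : root_datum C}.
Local Notation X := (Xl D).
Local Notation Y := (Yl D).
Context {A : algType Qv} {E F : I -> A} {K : Y -> A}.
Hypothesis relA : qg_relations E F K.

(** This is what makes [omega] well defined. Exchanging E and F reverses the commutator, inverting K
    reverses K_i - K_{-i}, and the two signs cancel. *)
Lemma relations_omega : qg_relations F E (fun mu => K (- mu)).
Proof.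
case: relA => K0 KD KE KF EF SE SF; split=> //.
- by rewrite oppr0.
- by move=> mu nu; rewrite opprD KD.
- by move=> mu i; rewrite KF pairingNl opprK.
- by move=> mu i; rewrite KE pairingNl.
- move=> i j; rewrite -[F i * _ - _]opprB EF eq_sym.
  case: eqP => [->|_]; last by rewrite oppr0.
  by rewrite opprK -scalerN opprB.
Qed.

Definition ugen_map (E' F' : I -> A) (K' : Y -> A) (g : Ugen D) : A :=
  match g with
  | inl (inl i) => E' i
  | inl (inr i) => F' i
  | inr mu => K' mu
  end.

Lemma ugen_map_rel r : U_rel r -> free_lift (ugen_map E F K) r = 0.
Proof.
have wl := free_lift_linear (ugen_map E F K).
have w1 := free_lift1 (ugen_map E F K).
have wM := free_liftM (ugen_map E F K).
have wE i : free_lift (ugen_map E F K) (gE D i) = E i by exact: free_lift_gen.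
have wF i : free_lift (ugen_map E F K) (gF D i) = F i by exact: free_lift_gen.
have wK mu : free_lift (ugen_map E F K) (gK mu) = K mu by exact: free_lift_gen.
case: relA => K0 KD KE KF EF SE SF.
case=> [|mu nu|mu i|mu i|i j|i j ij|i j ij].
- by apply: etrans (morph_sub1 wl w1 _) _; rewrite wK K0 subrr.
- by apply: etrans (morph_subM wl wM _ _ _) _; rewrite !wK KD subrr.
- by apply: etrans (morph_qcomm wl wM _ _ _) _; rewrite wK wE KE subrr.
- by apply: etrans (morph_qcomm wl wM _ _ _) _; rewrite wK wF KF subrr.
- by apply: etrans (morph_comm wl wM _ _ _ _ _ _) _; rewrite wE wF !wK EF subrr.
- apply: etrans (Serre_morph _ _ _ _ wl w1 wM) _; rewrite -[RHS](SE _ _ ij).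
  by congr (Serre C _ i j); apply: functional_extensionality_dep.
- apply: etrans (Serre_morph _ _ _ _ wl w1 wM) _; rewrite -[RHS](SF _ _ ij).
  by congr (Serre C _ i j); apply: functional_extensionality_dep.
Qed.

(** Expresses that [A] is generated as an algebra by the E, F and K; for [U] it is [U_ind]. *)
Hypothesis indA : forall P : A -> Prop, P 1 ->
  (forall i x, P x -> P (E i * x)) -> (forall i x, P x -> P (F i * x)) ->
  (forall mu x, P x -> P (K mu * x)) ->
  (forall a x y, P x -> P y -> P (a *: x + y)) -> forall x, P x.

Section Omega.
Context (w : A -> A).
Hypotheses (wl : linear w) (w1 : w 1 = 1) (wM : {morph w : x y / x * y}).
Hypotheses (wE : forall i, w (E i) = F i) (wF : forall i, w (F i) = E i).
Hypotheses (wK : forall mu, w (K mu) = K (- mu)).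

Lemma abs_omegaK : involutive w.
Proof.
apply: indA => [|i x IH|i x IH|mu x IH|a x y IHx IHy]; rewrite ?w1 //.
- by rewrite !wM wE wF IH.
- by rewrite !wM wF wE IH.
- by rewrite !wM !wK opprK IH.
- by rewrite !wl IHx IHy.
Qed.

Lemma abs_omega_hom d u : (forall mu, K mu * u = v ^ pairing mu d *: (u * K mu)) ->
  forall mu, K mu * w u = v ^ pairing mu (- d) *: (w u * K mu).
Proof.
move=> hu mu; have := congr1 w (hu (- mu)).
by rewrite (linZ wl) !wM !wK opprK pairingNl pairingN.
Qed.
End Omega.

Definition ahom (d : X) : set A :=
  [set u | forall mu, K mu * u = v ^ pairing mu d *: (u * K mu)].

(* Conjugation by [K mu]; the degree-[d] part consists of the joint eigenvectors
   of eigenvalue [v ^ <mu, d>]. *)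
Definition Kconj (mu : Y) (u : A) : A := K mu * u * K (- mu).

Lemma KV mu : K mu * K (- mu) = 1.
Proof. by rewrite -(rel_KD relA) subrr (rel_K0 relA). Qed.

Lemma Kconj_linear mu : linear (Kconj mu).
Proof. by move=> a x y; rewrite /Kconj mulrDr mulrDl -scalerAr -scalerAl. Qed.

Lemma ahom_Kconj d u mu : ahom d u -> Kconj mu u = v ^ pairing mu d *: u.
Proof. by move=> hu; rewrite /Kconj hu -scalerAl -mulrA KV mulr1. Qed.

Lemma ahom1 : ahom 0 1.
Proof. by move=> mu; rewrite pairing0 expr0z scale1r mulr1 mul1r. Qed.

Lemma ahomM d e u w : ahom d u -> ahom e w -> ahom (d + e) (u * w).
Proof.
move=> hu hw mu; rewrite mulrA hu -scalerAl -[u * _ * w]mulrA hw -scalerAr scalerA mulrA.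
by rewrite pairingD -expfzDr ?v_neq0.
Qed.

Lemma ahom_span d u : span (ahom d) u -> ahom d u.
Proof.
move=> S mu; apply/eqP; rewrite -subr_eq0; apply/eqP.
apply: (lin_span0 (h := fun u => K mu * u - v ^ pairing mu d *: (u * K mu))) S => [|x ->].
  apply: linear_sub (mul_linear_r _) _.
  exact: linear_comp (linear_scale _) (mul_linear_l _).
by rewrite subrr.
Qed.

Lemma ahomB d u w : ahom d u -> ahom d w -> ahom d (u - w).
Proof. by move=> hu hw; apply/ahom_span/spanB; exact: span_sub. Qed.

Lemma ahomE i : ahom (iX D i) (E i).
Proof. by move=> mu; exact: rel_KE relA mu i. Qed.
Lemma ahomF i : ahom (- iX D i) (F i).
Proof. by move=> mu; rewrite (rel_KF relA) pairingN. Qed.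
Lemma ahomK mu : ahom 0 (K mu).
Proof.
by move=> nu; rewrite pairing0 expr0z scale1r -!(rel_KD relA) addrC.
Qed.

Lemma span_ahom (u : A) : span [set u | exists d, ahom d u] u.
Proof.
have mulS d g x : ahom d g -> span [set u | exists d, ahom d u] x ->
    span [set u | exists d, ahom d u] (g * x).
  move=> hg; apply: (lin_span (mul_linear_r g)) => {}x [e hx].
  by apply: span_sub; exists (d + e); exact: ahomM.
move: u; apply: indA => [|i x|i x|mu x|a x y]; last exact: span_lin.
- by apply: span_sub; exists 0; exact: ahom1.
- exact: mulS (ahomE i).
- exact: mulS (ahomF i).
- exact: mulS (ahomK mu).
Qed.

Lemma ahom_sep (d e : X) : d <> e ->
  exists mu : Y, v ^ pairing mu d <> v ^ pairing mu e.
Proof.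
move=> de; apply: contrapT => /forallNP h; apply/de/pairing_sep => mu.
by apply: vexpz_inj; apply: contrapT; exact: h.
Qed.

Lemma ahom_weight_span (S : set A) d u :
  (forall x, S x -> exists e, ahom e x) -> span S u -> ahom d u ->
  span (S `&` ahom d) u.
Proof.
apply: (weight_span Kconj_linear (chi := fun mu e => v ^ pairing mu e)).
- by move=> e x mu; exact: ahom_Kconj.
- exact: ahom_sep.
- exact: ahom_span.
Qed.

Lemma ahom_degree d e u : ahom d u -> ahom e u -> u <> 0 -> d = e.
Proof.
move=> hd he u0; apply: contrapT => /ahom_sep [mu]; apply.
apply/eqP; rewrite -subr_eq0; apply/eqP.
have /eqP := ahom_Kconj mu hd; rewrite (ahom_Kconj mu he) eq_sym -subr_eq0 -scalerBl.
by rewrite scaler_eq0 => /orP[/eqP|/eqP/u0].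
Qed.

Local Notation kz mu z := (K mu - (v ^ pairing mu z)%:A).

Definition zrel (z1 z2 : X) : set A := [set x | exists mu u,
  x = kz mu z1 * u \/ x = u * kz mu z2].

(** Moving K_mu past [a] costs v^<mu,z1-z2>, which is exactly the ratio of the eigenvalues at z1 and
    z2. So in degree z1 - z2 left relations are right relations. *)
Lemma kz_hom z1 z2 mu a : ahom (z1 - z2) a ->
  kz mu z1 * a = v ^ pairing mu (z1 - z2) *: (a * kz mu z2).
Proof.
move=> ha; rewrite mulrBl mulrBr scalerBr ha; congr (_ - _).
rewrite mulr_algl mulr_algr scalerA; congr (_ *: _).
by rewrite -expfzDr ?v_neq0 // -pairingD subrK.
Qed.

(* A homogeneous element vanishing in [_{z1}U_{z2}] lies in the left ideal alone. *)
Lemma zrel_hom z1 z2 (u : A) : ahom (z1 - z2) u -> span (zrel z1 z2) u ->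
  span [set x | exists mu a, ahom (z1 - z2) a /\ x = a * kz mu z2] u.
Proof.
move=> hu Su.
(* Relations with a homogeneous cofactor are themselves homogeneous, as [kz] has degree 0, and they
   still span [u]. They can thus be filtered by degree. *)
pose S : set A := [set x | exists mu d a,
  ahom d a /\ (x = kz mu z1 * a \/ x = a * kz mu z2)].
have kz0 mu z : ahom 0 (kz mu z).
  apply/ahom_span/spanB; apply: span_sub; first exact: ahomK.
  by apply/ahom_span/spanZ/span_sub; exact: ahom1.
have SH x : S x -> exists d, ahom d x.
  by case=> mu [d [a [ha [->|->]]]]; [exists (0 + d)|exists (d + 0)]; exact: ahomM.
have : span S u.
  apply: span_sub_span Su => _ [mu [w [->|->]]].
    apply: (lin_span (mul_linear_r _)) (span_ahom w) => x [d hx].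
    by apply: span_sub; exists mu, d, x; split=> //; left.
  apply: (lin_span (mul_linear_l _)) (span_ahom w) => x [d hx].
  by apply: span_sub; exists mu, d, x; split=> //; right.
move=> /(ahom_weight_span SH) /(_ hu).
apply: span_sub_span => x [[mu [d [a [ha ex]]]] hx].
have [->|x0] := pselect (x = 0); first exact: span0.
have hd : d = z1 - z2.
  apply: (ahom_degree _ hx x0).
  by case: ex => ->; [rewrite -[d]add0r|rewrite -[d]addr0]; exact: ahomM.
rewrite {}hd in ha; case: ex => ->; last by apply: span_sub; exists mu, a.
by rewrite (kz_hom _ ha); apply/spanZ/span_sub; exists mu, a.
Qed.

(** Homogeneity allows every relation in [u] to be written with its factor [kz mu z1] on the left,
    where a right multiple by any [w] does no harm. *)
Lemma zrel_mulr z1 z2 z3 u w : ahom (z1 - z2) u -> span (zrel z1 z2) u ->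
  span (zrel z1 z3) (u * w).
Proof.
move=> hu /(zrel_hom hu); apply: (lin_span (mul_linear_l w)) => _ [mu [a [ha ->]]].
have -> : a * kz mu z2 = v ^ (- pairing mu (z1 - z2)) *: (kz mu z1 * a).
  by rewrite (kz_hom _ ha) scalerA -expfzDr ?v_neq0 // addNr expr0z scale1r.
rewrite -scalerAl; apply/spanZ/span_sub; exists mu, (a * w).
by left; rewrite mulrA.
Qed.

Lemma zrel_mull z1 z2 z3 u w : ahom (z1 - z2) u -> span (zrel z2 z3) w ->
  span (zrel z1 z3) (u * w).
Proof.
move=> hu; apply: (lin_span (mul_linear_r u)) => _ [mu [a [->|->]]].
  rewrite mulrA; apply: (zrel_mulr (z2 := z2)).
    by rewrite -[z1 - z2]addr0; apply: ahomM => //; apply/ahom_span/spanB; apply: span_sub;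
      [exact: ahomK|apply/ahom_span/spanZ/span_sub; exact: ahom1].
  by apply: span_sub; exists mu, u; right.
by rewrite mulrA; apply: span_sub; exists mu, (u * a); right.
Qed.

(** Independence of the product from representatives, in the asymmetric form of [Udot_mul]:
    homogeneous on the left, arbitrary on the right. *)
Lemma zrel_mul z1 z2 z3 u u' w w' :
  ahom (z1 - z2) u -> ahom (z1 - z2) u' -> span (zrel z1 z2) (u - u') ->
  span (zrel z2 z3) (w - w') -> span (zrel z1 z3) (u * w - u' * w').
Proof.
move=> hu hu' Su Sw.
have -> : u * w - u' * w' = (u - u') * w + u' * (w - w').
  by rewrite mulrBl mulrBr addrA subrK.
apply: spanD; last exact: zrel_mull Sw.
by apply: zrel_mulr Su; exact: ahomB.
Qed.

(** By [zrel_hom], [u] lies in the left ideal generated by the [kz mu z2], and each of these kills a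
    vector of weight z2. *)
Lemma zrel_act (M : lmodType Qv) (act : A -> M -> M) z1 z2 u m :
  (forall m, linear (act^~ m)) -> (forall x y m, act (x * y) m = act x (act y m)) ->
  (forall mu, act (K mu) m = v ^ pairing mu z2 *: m) -> act 1 m = m ->
  (forall x, linear (act x)) ->
  ahom (z1 - z2) u -> span (zrel z1 z2) u -> act u m = 0.
Proof.
move=> al aM aK a1 ar hu /(zrel_hom hu); apply: (lin_span0 (al m)) => _ [mu [a [_ ->]]].
by rewrite aM (linB (al m)) aK (linZ (al m)) a1 subrr (lin0 (ar a)).
Qed.

End AbstractQuantumGroup.

Section QuantumGroupFacts.
Context {I : finType} {C : cartan_datum I} {D : root_datum C}.
Local Notation U := (U D).
Local Notation X := (Xl D).
Local Notation Y := (Yl D).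
Local Notation UE := (@UE _ _ D).
Local Notation UF := (@UF _ _ D).
Local Notation UK := (@UK _ _ D).
Local Notation omega := (@omega _ _ D).
Local Notation f := (f C).

Lemma U_pi_linear : linear (@U_pi _ _ D).
Proof. exact: linearP. Qed.
Lemma U_piM : {morph @U_pi _ _ D : x y / x * y}.
Proof. exact: rmorphM. Qed.
Lemma U_pi1 : @U_pi _ _ D 1 = 1.
Proof. exact: rmorph1. Qed.
Lemma U_pi_rel r : U_rel r -> @U_pi _ _ D r = 0.
Proof.
move=> Rr; rewrite -(lin0 U_pi_linear); apply/eq_api; rewrite subr0.
by apply: span_sub; exists 1, r, 1; rewrite mulr1 mul1r.
Qed.

Lemma U_relations : qg_relations UE UF UK.
Proof.
have piS (x : I -> free_alg Qv (Ugen D)) i j :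
    Serre C (fun k => U_pi (x k)) i j = U_pi (Serre C x i j).
  exact: esym (Serre_morph _ _ _ _ U_pi_linear U_pi1 U_piM).
split=> [|mu nu|mu i|mu i|i j|i j ij|i j ij].
- apply: subr0_eq; apply: etrans (U_pi_rel (U_K0 D)).
  exact: esym (morph_sub1 U_pi_linear U_pi1 _).
- apply: subr0_eq; apply: etrans (U_pi_rel (U_KD mu nu)).
  exact: esym (morph_subM U_pi_linear U_piM _ _ _).
- apply: subr0_eq; apply: etrans (U_pi_rel (U_KE mu i)).
  exact: esym (morph_qcomm U_pi_linear U_piM _ _ _).
- apply: subr0_eq; apply: etrans (U_pi_rel (U_KF mu i)).
  exact: esym (morph_qcomm U_pi_linear U_piM _ _ _).
- apply: subr0_eq; apply: etrans (U_pi_rel (U_EF D i j)).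
  exact: esym (morph_comm U_pi_linear U_piM _ _ _ _ _ _).
- exact: etrans (piS _ _ _) (U_pi_rel (U_SerreE D ij)).
- exact: etrans (piS _ _ _) (U_pi_rel (U_SerreF D ij)).
Qed.

Let omega_rel r : U_rel r -> free_lift (ugen_map UF UE (fun mu => UK (- mu))) r = 0.
Proof. exact: ugen_map_rel (relations_omega U_relations) r. Qed.

Lemma omega_linear : linear omega.
Proof. exact: (quo_lift_linear omega_rel). Qed.
Lemma omegaM : {morph omega : x y / x * y}.
Proof. exact: (quo_liftM omega_rel). Qed.
Lemma omega1 : omega 1 = 1.
Proof. exact: (quo_lift1 (@U_proper _ _ D) omega_rel). Qed.
Lemma omegaE i : omega (UE i) = UF i.
Proof. exact: (quo_lift_gen (@U_proper _ _ D) omega_rel (inl (inl i))). Qed.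
Lemma omegaF i : omega (UF i) = UE i.
Proof. exact: (quo_lift_gen (@U_proper _ _ D) omega_rel (inl (inr i))). Qed.
Lemma omega_UK mu : omega (UK mu) = UK (- mu).
Proof. exact: (quo_lift_gen (@U_proper _ _ D) omega_rel (inr mu)). Qed.

Lemma U_ind (P : U -> Prop) :
  P 1 -> (forall i x, P x -> P (UE i * x)) -> (forall i x, P x -> P (UF i * x)) ->
  (forall mu x, P x -> P (UK mu * x)) ->
  (forall a x y, P x -> P y -> P (a *: x + y)) -> forall x, P x.
Proof.
move=> P1 PE PF PK Pl; apply: aquo_ind => // -[[i|i]|mu].
- exact: PE.
- exact: PF.
- exact: PK.
Qed.

Lemma omegaK : involutive omega.
Proof. exact: (abs_omegaK U_ind omega_linear omega1 omegaM omegaE omegaF omega_UK). Qed.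

Lemma omega_fplus x : omega (fplus D x) = fminus D x.
Proof.
apply: etrans (free_lift_comp _ omega_linear omega1 omegaM _) _.
apply: (congr1 (fun h => free_lift h (f_repr x))).
by apply: functional_extensionality_dep => i; exact: omegaE.
Qed.

Lemma omega_fminus x : omega (fminus D x) = fplus D x.
Proof. by rewrite -omega_fplus omegaK. Qed.

Lemma fplus_linear : linear (@fplus _ _ D).
Proof.
apply: (quo_lift_linear (proper := @f_proper _ C)) => r; case=> i j ij.
apply: etrans (Serre_morph _ _ _ _ (free_lift_linear _) (free_lift1 _) (free_liftM _)) _.
rewrite -[RHS](rel_SE U_relations ij); congr (Serre C _ i j).
by apply: functional_extensionality_dep => k; exact: free_lift_gen.
Qed.

Lemma omega_dpow x n : omega (dpow x n) = dpow (omega x) n.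
Proof. exact: dpow_morph omega_linear omega1 omegaM. Qed.

Lemma omega_hom (d : X) u : Uhom d u -> Uhom (- d) (omega u).
Proof. exact: (abs_omega_hom omega_linear omegaM omega_UK). Qed.

(** Since <-mu,-z> = <mu,z>, [omega] sends the relation for mu at z to the relation for -mu at
    -z. *)
Lemma Uz_rel_omega (z1 z2 : X) u :
  span (Uz_rel z1 z2) u -> span (Uz_rel (- z1) (- z2)) (omega u).
Proof.
apply: (lin_span omega_linear) => x [mu [a ex]]; apply: span_sub.
have kzE z : omega (UK mu - (v ^ pairing mu z)%:A) = UK (- mu) - (v ^ pairing (- mu) (- z))%:A.
  rewrite (linB omega_linear) (linZ omega_linear) omega1 omega_UK.
  by rewrite pairingN pairingNl opprK.
exists (- mu), (omega a); case: ex => ->; [left|right]; rewrite omegaM.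
  by congr (_ * _); exact: kzE.
by congr (_ * _); exact: kzE.
Qed.

End QuantumGroupFacts.

(** * Modules and the coproduct *)

Section LeftQuotient.
Context {A : algType Qv} (R : set A).

(** Abstract counterpart of [left_ideal_gens]; likewise [lact] is that of [act_Lam], whose
    properties below are instances by conversion. *)
Definition lgens : set A := [set x | exists u r, R r /\ x = u * r].
Definition lact (u : A) (m : quo lgens) : quo lgens := qpi lgens (u * qrepr m).

Lemma lgens_mul a x : span lgens x -> span lgens (a * x).
Proof.
apply: (lin_span (mul_linear_r a)) => _ [u [r [Rr ->]]].
by apply: span_sub; exists (a * u), r; rewrite mulrA.
Qed.

Lemma lact_qpi u x : lact u (qpi lgens x) = qpi lgens (u * x).
Proof. by apply/eq_qpi; rewrite -mulrBr; exact/lgens_mul/qrepr_qpi. Qed.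

Lemma lact_linear_l m : linear (fun u => lact u m).
Proof. by move=> a x y; rewrite /lact mulrDl -scalerAl linearP. Qed.

Lemma lact_linear_r u : linear (lact u).
Proof.
move=> a m n; rewrite -[m]qreprK -[n]qreprK -linearP !lact_qpi.
by rewrite mulrDr -scalerAr linearP.
Qed.

Lemma lactM x y m : lact (x * y) m = lact x (lact y m).
Proof. by rewrite -[m]qreprK !lact_qpi mulrA. Qed.

Lemma lact1 m : lact 1 m = m.
Proof. by rewrite -[m]qreprK lact_qpi mul1r. Qed.

Lemma lact_gen (c : Qv) x : R (x - c%:A) -> lact x (qpi lgens 1) = c *: qpi lgens 1.
Proof.
move=> Rx; rewrite lact_qpi mulr1 -linearZ; apply/eq_qpi/span_sub.
by exists 1, (x - c%:A); rewrite mul1r.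
Qed.
End LeftQuotient.

Section TensorProductAlgebra.
Context {A : algType Qv}.
Let ml := @mul_linear_l _ A.
Let mr := @mul_linear_r _ A.

Lemma tens_mul_pure (x y x' y' : A) :
  tens_mul (pure x y) (pure x' y') = pure (x * x') (y * y').
Proof. exact: (@tens_act_pure2 Qv A A A A *%R *%R ml mr ml mr). Qed.

Lemma tens_mul_linear_l (t : tens A A) : linear (fun s => tens_mul s t).
Proof. exact: (@tens_act_linear_l Qv A A A A *%R *%R ml mr ml mr). Qed.

Lemma tens_mul_linear_r (s : tens A A) : linear (tens_mul s).
Proof. exact: (@tens_act_linear_r Qv A A A A *%R *%R ml mr ml mr). Qed.
End TensorProductAlgebra.

Section TensorActions.
Context {A : algType Qv} {M N : lmodType Qv} (a : A -> M -> M) (b : A -> N -> N).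
Hypotheses (al : forall m, linear (a^~ m)) (ar : forall x, linear (a x)).
Hypotheses (bl : forall n, linear (b^~ n)) (br : forall y, linear (b y)).

Let actl := tens_act_linear_l al ar bl br.
Let actr := tens_act_linear_r al ar bl br.
Let actp := tens_act_pure2 al ar bl br.
Lemma tens_actM : (forall x y m, a (x * y) m = a x (a y m)) ->
  (forall x y n, b (x * y) n = b x (b y n)) ->
  forall s t w, tens_act a b (tens_mul s t) w = tens_act a b s (tens_act a b t w).
Proof.
move=> aM bM s t w; move: s; apply: tens_ext => [||x y].
- exact: linear_comp (actl w) (tens_mul_linear_l t).
- exact: actl.
move: t; apply: tens_ext => [||x' y'].
- exact: linear_comp (actl w) (tens_mul_linear_r (pure x y)).
- exact: linear_comp (actr _) (actl w).
move: w; apply: tens_ext => [||m n].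
- exact: actr.
- exact: linear_comp (actr _) (actr _).
by rewrite tens_mul_pure !actp aM bM.
Qed.

(** On pure tensors both sides are [b y n] tensor [a (w x) m], because [w (w y) = y]. The twist sits
    on the first factor both before and after the flip. *)
Lemma tens_act_twist (w : A -> A) s t : linear w -> involutive w ->
  tswap (tens_act (fun u => a (w u)) b s t) =
  tens_act (fun u => b (w u)) a (tswap (tmap w w s)) (tswap t).
Proof.
move=> wl wK.
have awl m : linear (fun u => a (w u) m) by exact: linear_comp (al m) wl.
have bwl n : linear (fun u => b (w u) n) by exact: linear_comp (bl n) wl.
have awr u : linear (a (w u)) by exact: ar.
have bwr u : linear (b (w u)) by exact: br.
move: s; apply: tens_ext => [||x y].
- exact: linear_comp (@tswap_linear _ _ _) (tens_act_linear_l awl awr bl br t).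
- apply: linear_comp (tens_act_linear_l bwl bwr al ar _) _.
  exact: linear_comp (@tswap_linear _ _ _) (tmap_linear wl wl).
move: t; apply: tens_ext => [||m n].
- exact: linear_comp (@tswap_linear _ _ _) (tens_act_linear_r awl awr bl br _).
- exact: linear_comp (tens_act_linear_r bwl bwr al ar _) (@tswap_linear _ _ _).
rewrite (tens_act_pure2 awl awr bl br) (tmap_pure wl wl) !tswap_pure.
by rewrite (tens_act_pure2 bwl bwr al ar) wK.
Qed.
End TensorActions.

Section Coproduct.
Context {I : finType} {C : cartan_datum I} {D : root_datum C}.
Context {A : algType Qv} {E F : I -> A} {K : Yl D -> A}.

Definition coproduct_on (d : A -> tens A A) : Prop :=
  [/\ linear d, d 1 = pure 1 1, forall x y, d (x * y) = tens_mul (d x) (d y),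
      forall i, d (E i) = pure (E i) 1 + pure (K (iY D i)) (E i) &
      (forall i, d (F i) = pure 1 (F i) + pure (F i) (K (- iY D i))) /\
      (forall mu, d (K mu) = pure (K mu) (K mu))].

Context (w : A -> A).
Hypotheses (wl : linear w) (w1 : w 1 = 1) (wM : {morph w : x y / x * y}).
Hypotheses (wE : forall i, w (E i) = F i) (wF : forall i, w (F i) = E i).
Hypotheses (wK : forall mu, w (K mu) = K (- mu)).

(** The flip composed with [w] on both factors is multiplicative and exchanges the coproduct
    formulas of E and F. Uniqueness of the coproduct then identifies it with its twist in
    [Delta_omega]. *)
Lemma coproduct_twist d : coproduct_on d ->
  coproduct_on (fun u => tswap (tmap w w (d (w u)))).
Proof.
case=> dl d1 dM dE [dF dK].
have tl : linear (fun s => tswap (tmap w w s)).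
  exact: linear_comp (@tswap_linear _ _ _) (tmap_linear wl wl).
have tp x y : tswap (tmap w w (pure x y)) = pure (w y) (w x).
  by rewrite (tmap_pure wl wl) tswap_pure.
have tM s t : tswap (tmap w w (tens_mul s t)) =
    tens_mul (tswap (tmap w w s)) (tswap (tmap w w t)).
  move: s; apply: tens_ext => [||x y].
  - exact: linear_comp tl (tens_mul_linear_l t).
  - exact: linear_comp (tens_mul_linear_l (tswap (tmap w w t))) tl.
  move: t; apply: tens_ext => [||x' y'].
  - exact: linear_comp tl (tens_mul_linear_r (pure x y)).
  - exact: linear_comp (tens_mul_linear_r (tswap (tmap w w (pure x y)))) tl.
  apply: (@etrans _ _ (pure (w (y * y')) (w (x * x')))).
    exact: etrans (congr1 (fun s => tswap (tmap w w s)) (tens_mul_pure _ _ _ _)) (tp _ _).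
  apply: (etrans (f_equal2 (@pure Qv A A) (wM _ _) (wM _ _))); apply: esym.
  exact: etrans (f_equal2 (@tens_mul Qv A A) (tp _ _) (tp _ _)) (tens_mul_pure _ _ _ _).
split=> [|||i|]; last split=> [i|mu].
- exact: linear_comp tl (linear_comp dl wl).
- by rewrite w1 d1 tp w1.
- by move=> x y; apply: etrans (tM _ _); rewrite wM; congr (tswap (tmap w w _)).
- rewrite wE dF; apply: etrans (linD tl _ _) _.
  by congr (_ + _); apply: etrans (tp _ _) _; rewrite ?w1 wF ?wK ?opprK.
- rewrite wF dE; apply: etrans (linD tl _ _) _.
  by congr (_ + _); apply: etrans (tp _ _) _; rewrite ?w1 wE ?wK.
- by rewrite wK dK tp wK opprK.
Qed.
End Coproduct.

Section ModuleFacts.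
Context {I : finType} {C : cartan_datum I} {D : root_datum C}.
Local Notation U := (U D).
Local Notation X := (Xl D).
Local Notation UK := (@UK _ _ D).
Local Notation omega := (@omega _ _ D).

Lemma act_Lam_linear_l (lam : X) m : linear (fun u => act_Lam (lam := lam) u m).
Proof. exact: lact_linear_l. Qed.
Lemma act_Lam_linear_r (lam : X) u : linear (act_Lam (lam := lam) u).
Proof. exact: lact_linear_r. Qed.
Lemma act_LamM (lam : X) x y m :
  act_Lam (lam := lam) (x * y) m = act_Lam x (act_Lam y m).
Proof. exact: lactM. Qed.
Lemma act_Lam1 (lam : X) m : act_Lam (lam := lam) 1 m = m.
Proof. exact: lact1. Qed.
Lemma act_eta (lam : X) mu : act_Lam (UK mu) (eta lam) = v ^ pairing mu lam *: eta lam.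
Proof. by apply: lact_gen; exact: Lam_K. Qed.

Lemma act_oLam_linear_l (lam : X) m : linear (fun u => act_oLam (lam := lam) u m).
Proof. exact: linear_comp (act_Lam_linear_l m) omega_linear. Qed.
Lemma act_oLam_linear_r (lam : X) u : linear (act_oLam (lam := lam) u).
Proof. exact: act_Lam_linear_r. Qed.
Lemma act_oLamM (lam : X) x y m :
  act_oLam (lam := lam) (x * y) m = act_oLam x (act_oLam y m).
Proof. by rewrite /act_oLam /act_omega omegaM act_LamM. Qed.
Lemma act_oLam1 (lam : X) m : act_oLam (lam := lam) 1 m = m.
Proof. by rewrite /act_oLam /act_omega omega1 act_Lam1. Qed.
Lemma act_xi (lam : X) mu : act_oLam (UK mu) (xi lam) = v ^ pairing mu (- lam) *: xi lam.
Proof.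
rewrite /act_oLam /act_omega omega_UK pairingN -pairingNl; exact: act_eta.
Qed.

Lemma act_oLam_fplus (lam : X) b m :
  act_oLam (lam := lam) (fplus D b) m = act_Lam (fminus D b) m.
Proof. by rewrite /act_oLam /act_omega omega_fplus. Qed.
Lemma act_oLam_fminus (lam : X) b m :
  act_oLam (lam := lam) (fminus D b) m = act_Lam (fplus D b) m.
Proof. by rewrite /act_oLam /act_omega omega_fminus. Qed.

(** The action of b^+ on the twisted module is that of omega(b^+) = b^- on the same vector space. *)
Lemma BoLamE (lam : X) : @BoLam _ _ D lam = @BLam _ _ D lam.
Proof.
apply/seteqP; split=> m [m0 [b Bb em]]; (split; [exact: m0|exists b; [exact: Bb|]]).
  exact: etrans em (act_oLam_fplus _ _).
exact: etrans em (esym (act_oLam_fplus _ _)).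
Qed.

Lemma Delta_cases : is_coproduct (@Delta _ _ D) \/ forall u, @Delta _ _ D u = 0.
Proof.
have [ex|nex] := pselect (exists! d, @is_coproduct _ _ D d).
  by left; exact: the_spec ex.
by right=> u; rewrite /Delta (the_default _ nex).
Qed.

Lemma Delta_omega u : Delta (omega u) = tswap (tmap omega omega (Delta u)).
Proof.
have [[d [dP du]]|nex] := pselect (exists! d, @is_coproduct _ _ D d); last first.
  have D0 x : @Delta _ _ D x = 0 by rewrite /Delta (the_default _ nex).
  rewrite !D0 (lin0 (tmap_linear omega_linear omega_linear)).
  by rewrite (lin0 (@tswap_linear _ _ _)).
have -> : @Delta _ _ D = d by apply: the_unique.
have := du _ (coproduct_twist omega_linear omega1 omegaM (@omegaE _ _ D)
  (@omegaF _ _ D) (@omega_UK _ _ D) dP).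
by move=> /(congr1 (fun d => d (omega u))); rewrite omegaK.
Qed.

Section ActM.
Context (lam1 lam2 : X).

Lemma act_M_swap u w :
  tswap (act_M (lam1 := lam1) (lam2 := lam2) u w) = act_M (omega u) (tswap w).
Proof.
rewrite /act_M /act_tens Delta_omega; apply: tens_act_twist => //.
- exact: act_Lam_linear_l.
- exact: act_Lam_linear_r.
- exact: act_Lam_linear_l.
- exact: act_Lam_linear_r.
- exact: omega_linear.
- exact: omegaK.
Qed.

Lemma act_M_linear_l w : linear (fun u => act_M (lam1 := lam1) (lam2 := lam2) u w).
Proof.
have tl := tens_act_linear_l (@act_oLam_linear_l lam1) (@act_oLam_linear_r lam1)
  (@act_Lam_linear_l lam2) (@act_Lam_linear_r lam2) w.
have [[Dl _ _ _ _]|D0 a x y] := Delta_cases; first exact: linear_comp tl Dl.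
by rewrite /act_M /act_tens !D0 (lin0 tl) scaler0 addr0.
Qed.

Lemma act_M_linear_r u : linear (act_M (lam1 := lam1) (lam2 := lam2) u).
Proof.
exact: tens_act_linear_r (@act_oLam_linear_l lam1) (@act_oLam_linear_r lam1)
  (@act_Lam_linear_l lam2) (@act_Lam_linear_r lam2) _.
Qed.

(** The tensor [pure (xi lam1) (eta lam2)] has weight lam2 - lam1, so [zrel_act] applies. Thus the
    homogeneous representative chosen in [Udot_act] does not affect the result. *)
Lemma act_M_hom0 z1 u : Uhom (z1 - (lam2 - lam1)) u ->
  span (Uz_rel z1 (lam2 - lam1)) u -> act_M u (pure (xi lam1) (eta lam2)) = 0.
Proof.
have [[Dl D1 DM DE [DF DK]]|D0] := Delta_cases; last first.
  move=> _ _; rewrite /act_M /act_tens D0.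
  exact: (lin0 (tens_act_linear_l (@act_oLam_linear_l lam1) (@act_oLam_linear_r lam1)
    (@act_Lam_linear_l lam2) (@act_Lam_linear_r lam2) _)).
have actp := tens_act_pure2 (@act_oLam_linear_l lam1) (@act_oLam_linear_r lam1)
    (@act_Lam_linear_l lam2) (@act_Lam_linear_r lam2).
apply: (zrel_act U_relations U_ind act_M_linear_l _ _ _ act_M_linear_r).
- move=> x y m; rewrite /act_M /act_tens DM; apply: tens_actM.
  + exact: act_oLam_linear_l.
  + exact: act_oLam_linear_r.
  + exact: act_Lam_linear_l.
  + exact: act_Lam_linear_r.
  + exact: act_oLamM.
  + exact: act_LamM.
- move=> mu; rewrite /act_M /act_tens DK actp act_xi act_eta; apply: pureZZ.
  by rewrite -expfzDr ?v_neq0 // -pairingD [- _ + _]addrC.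
- by rewrite /act_M /act_tens D1 actp act_oLam1 act_Lam1.
Qed.
End ActM.
End ModuleFacts.

(** * Dual bases and the map [Psi] *)

Section FreeFamilies.
Context {K : fieldType} {V : lmodType K}.

Definition free_set (T : set V) : Prop := forall (s : seq V) (c : V -> K),
  uniq s -> (forall b, b \in s -> T b) -> \sum_(b <- s) c b *: b = 0 ->
  forall b, b \in s -> c b = 0.

Lemma span_seq (r : seq V) x : span [set` r] x ->
  exists c : 'I_(size r) -> K, x = \sum_j c j *: r`_j.
Proof.
elim=> [y /= yr||a y z _ [c ->] _ [d ->]].
- have yi : (index y r < size r)%N by rewrite index_mem.
  exists (fun j => if j == Ordinal yi then 1 else 0).
  rewrite (bigD1 (Ordinal yi)) //= eqxx scale1r nth_index // big1 ?addr0 // => j /negbTE ->.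
  by rewrite scale0r.
- by exists (fun=> 0); rewrite big1 // => j _; rewrite scale0r.
- exists (fun j => a * c j + d j); rewrite scaler_sumr -big_split.
  by apply: eq_bigr => j _; rewrite scalerDl scalerA.
Qed.

Lemma free_nth_sum (T : set V) (s : seq V) (c : 'rV[K]_(size s)) :
  free_set T -> uniq s -> (forall b, b \in s -> T b) ->
  \sum_j c 0 j *: s`_j = 0 -> c = 0.
Proof.
move=> fT us sT e0; apply/rowP => j; rewrite mxE.
pose d b := if (insub (index b s) : option 'I_(size s)) is Some i then c 0 i else 0.
have dE i : d s`_(i : 'I_(size s)) = c 0 i.
  by rewrite /d index_uniq // valK.
rewrite -dE; apply: (fT s) => //; last exact: mem_nth.
rewrite (big_nth 0) big_mkord -[RHS]e0.
by apply: eq_bigr => i _; rewrite dE.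
Qed.

(** More than [size r] vectors in the span of [r] give a coefficient matrix with more rows than
    columns, and a nonzero vector of its left kernel is a linear relation. *)
Lemma free_set_finite (T : set V) (r : seq V) : free_set T ->
  (forall x, T x -> span [set` r] x) -> finite_set T.
Proof.
move=> fT Tr; apply: contrapT => /(infinite_set_fset (size r).+1) [B BT sB].
pose s : seq V := take (size r).+1 B.
have ss : size s = (size r).+1 by rewrite size_takel.
have us : uniq s by apply: take_uniq; exact: fset_uniq.
have sT b : b \in s -> T b by move=> /mem_take bB; exact: BT.
have ex (i : 'I_(size s)) : exists c : 'I_(size r) -> K, s`_i = \sum_j c j *: r`_j.
  by apply/span_seq/Tr/sT/mem_nth.
have [M HM] := choice ex.
pose G := \matrix_(i < size s, j < size r) M i j.
have : kermx G != 0.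
  rewrite kermx_eq0 -row_leq_rank -ltnNge.
  by apply: leq_ltn_trans (rank_leq_col G) _; rewrite ss.
rewrite -nz_row_eq0 => /negP; apply; apply/eqP; apply: (free_nth_sum fT us sT).
have /sub_kermxP kG := nz_row_sub (kermx G).
under eq_bigr => i _ do rewrite HM scaler_sumr.
rewrite exchange_big /= big1 // => j _.
under eq_bigr => i _ do rewrite scalerA.
rewrite -scaler_suml; have := congr1 (fun N : 'rV_(size r) => N 0 j) kG.
rewrite [X in X = _]mxE [X in _ = X]mxE => e.
rewrite (eq_bigr (fun i => nz_row (kermx G) 0 i * G i j)) ?e ?scale0r //.
by move=> i _; rewrite mxE.
Qed.
End FreeFamilies.

(* When the form is degenerate on the span of [s], no dual vector is unique, hence
   all of them take the default value 0. *)
Section DualBasis.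
Context {K : fieldType} {V : lmodType K} (S : set V) (Q : set V) (s : seq V).
Context (form : V -> V -> K).
Hypothesis form_linear : forall x, linear (form x : V -> K^o).
Hypothesis form_sym : forall x y, form x y = form y x.
Hypothesis S_span : forall x, span S x -> S x.
Hypothesis S_s : forall x, S x -> span [set` s] x.
Hypothesis sE : forall x, x \in s <-> Q x /\ S x.
Hypotheses (s_uniq : uniq s) (s_free : free_set [set` s]).

Definition dual_vector (x : V) : V := the 0 (fun y =>
  S y /\ forall b, Q b -> S b -> form y b = if b == x then 1 else 0).

Let n := size s.
Let e (i : 'I_n) := s`_i.
Let G := \matrix_(i, j) form (e i) (e j).

Let S_e i : S (e i).
Proof. by have /sE [] : e i \in s by exact: mem_nth. Qed.

Let S_sum (c : 'I_n -> K) : S (\sum_j c j *: e j).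
Proof. by apply/S_span/span_sum => j _; apply/spanZ/span_sub. Qed.

Let form_sum (c : 'I_n -> K) k :
  form (\sum_j c j *: e j) (e k) = \sum_j c j * G j k.
Proof.
rewrite form_sym (lin_sum (form_linear (e k))); apply: eq_bigr => j _.
by rewrite (linZ (form_linear (e k))) mxE form_sym.
Qed.

(** For an invertible Gram matrix [G], the conditions on a dual vector form a linear system solved
    by a row of the inverse. *)
Let dual_unit i : G \in unitmx ->
  dual_vector (e i) = \sum_j invmx G i j *: e j.
Proof.
move=> Gu; apply: the_unique; split.
  split=> [|b Qb Sb]; first exact: S_sum.
  have bs : b \in s by apply/sE.
  have bi : (index b s < n)%N by rewrite index_mem.
  have -> : b = e (Ordinal bi) by rewrite /e /= nth_index.
  rewrite form_sum nth_uniq //.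
  have := congr1 (fun M : 'M_n => M i (Ordinal bi)) (mulVmx Gu).
  by rewrite [X in X = _]mxE [X in _ = X]mxE => ->; rewrite -val_eqE eq_sym; case: eqP.
move=> y [Sy Hy]; have [c yE] := span_seq (S_s Sy).
rewrite {1}yE; apply: eq_bigr => j _; congr (_ *: _); move: j.
have cG : (\row_j c j) *m G = row i 1%:M.
  apply/rowP => k; rewrite !mxE.
  have := Hy _ (proj1 (iffLR (sE _) (mem_nth 0 (ltn_ord k)))) (S_e k).
  rewrite [in LHS]yE form_sum nth_uniq // => h.
  have -> : (i == k)%:R = if k == i :> nat then 1 else 0 :> K.
    by rewrite -val_eqE eq_sym; case: eqP.
  by rewrite -h; apply: eq_bigr => j _; rewrite [in LHS]mxE.
move=> j; have := congr1 (fun N => (N *m invmx G) 0 j) cG.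
by rewrite mulmxK // -row_mul mul1mx !mxE => <-.
Qed.

Let dual_nonunit x : G \notin unitmx -> dual_vector x = 0.
Proof.
move=> Gu; apply: the_default => -[y [[Sy Hy] uy]].
have : kermx G != 0 by rewrite kermx_eq0 row_free_unit.
rewrite -nz_row_eq0 => /negP; apply; apply/eqP.
apply: (free_nth_sum s_free s_uniq) => //.
have /sub_kermxP kG := nz_row_sub (kermx G).
set c := nz_row _ in kG *.
(* The combination with coefficients in the kernel of [G] is orthogonal to all of [s], so adding it
   gives another dual vector. Uniqueness then contradicts the freeness of [s]. *)
suff /(congr1 (fun z => z - y)) : y = y + \sum_j c 0 j *: e j.
  by rewrite subrr addrC addKr => <-.
apply: uy; split=> [|b Qb Sb].
  by apply/S_span/spanD; apply: span_sub => //; exact: S_sum.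
have bs : b \in s by apply/sE.
have bi : (index b s < n)%N by rewrite index_mem.
rewrite -Hy // [LHS]form_sym [RHS]form_sym (linD (form_linear b)).
rewrite [X in _ + X]form_sym.
have -> : b = e (Ordinal bi) by rewrite /e /= nth_index.
rewrite form_sum; have := congr1 (fun N : 'rV_n => N 0 (Ordinal bi)) kG.
by rewrite [X in X = _]mxE [X in _ = X]mxE => ->; rewrite addr0.
Qed.

(** Both sums expand with coefficients from the inverse Gram matrix, which is symmetric because the
    form is; for singular [G] all dual vectors are 0. *)
Lemma dual_basis_sym (W : lmodType K) (T : V -> V -> W) :
  (forall y, linear (T^~ y)) -> (forall x, linear (T x)) ->
  \sum_(x <- s) T x (dual_vector x) = \sum_(x <- s) T (dual_vector x) x.
Proof.
move=> Tl Tr.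
have sumE H : \sum_(x <- s) H x = \sum_(i < n) H (e i) :> W.
  by rewrite (big_nth 0) big_mkord.
rewrite !sumE.
have [Gu|Gu] := boolP (G \in unitmx); last first.
  by rewrite !big1 // => i _; rewrite dual_nonunit // ?(lin0 (Tl _)) ?(lin0 (Tr _)).
have Hsym i j : invmx G i j = invmx G j i.
  have : (invmx G)^T = invmx G.
    rewrite trmx_inv; congr invmx; apply/matrixP => k l.
    by rewrite !mxE form_sym.
  by move=> /(congr1 (fun N : 'M_n => N j i)); rewrite mxE.
transitivity (\sum_(i < n) \sum_(j < n) invmx G i j *: T (e i) (e j)).
  apply: eq_bigr => i _; rewrite dual_unit // (lin_sum (Tr _)).
  by apply: eq_bigr => j _; rewrite (linZ (Tr _)).
rewrite exchange_big; apply: eq_bigr => i _; rewrite dual_unit // (lin_sum (Tl _)).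
by apply: eq_bigr => j _; rewrite (linZ (Tl _)) Hsym.
Qed.
End DualBasis.

(** * The grading of f *)

Section ScaledGenerators.
Context {I : finType} {A : algType Qv}.

Lemma dpowZ (t : Qv) (x : A) n : dpow (t *: x) n = t ^+ n *: dpow x n.
Proof. by rewrite /dpow exprZn !scalerA mulrC. Qed.

(** Every term contains [x i] the same number n + (m - n) of times and [x j] once. Hence rescaling
    the generators respects the Serre relations, which makes [fscale] well defined. *)
Lemma SerreZ (C : cartan_datum I) (t : I -> Qv) (x : I -> A) i j :
  Serre C (fun k => t k *: x k) i j =
  (t i ^+ `|1 - C i j|%N * t j) *: Serre C x i j.
Proof.
have scale3 (a b c : Qv) (y z w : A) :
    (a *: y) * (b *: z) * (c *: w) = (a * b * c) *: (y * z * w).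
  rewrite -scalerAr -[_ * (b *: z)]scalerAr -!scalerAl !scalerA.
  by congr (_ *: _); rewrite mulrC [b * a]mulrC.
rewrite /Serre scaler_sumr; apply: eq_bigr => n _.
have nm : (n <= `|1 - C i j|)%N by rewrite -ltnS.
rewrite !dpowZ scale3 !scalerA; congr (_ *: _); rewrite mulrC; congr (_ * _).
by rewrite mulrAC -exprD subnKC.
Qed.

Lemma morph_scaled_word (w : A -> A) (t : I -> Qv) (x : I -> A) (s : seq I) :
  w 1 = 1 -> {morph w : y z / y * z} -> (forall i, w (x i) = t i *: x i) ->
  w (\prod_(i <- s) x i) = (\prod_(i <- s) t i) *: \prod_(i <- s) x i.
Proof.
move=> w1 wM wx; elim: s => [|i s IH]; first by rewrite !big_nil w1 scale1r.
by rewrite !big_cons wM wx IH -scalerAl -scalerAr scalerA.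
Qed.
End ScaledGenerators.

Section FGrading.
Context {I : finType} {C : cartan_datum I}.
Local Notation f := (f C).
Local Notation theta := (@theta _ C).
Local Notation B := (@canonical_basis _ C).

Definition scale_at (k i : I) : Qv := if i == k then v else 1.

(* Acts on [f_nu] as [v ^ nu k], so that these operators separate the degrees. *)
Definition fscale (k : I) (x : f) : f :=
  free_lift (fun i => scale_at k i *: theta i) (f_repr x).

Lemma f_pi_linear : linear (@f_pi _ C).
Proof. exact: linearP. Qed.
Lemma f_piM : {morph @f_pi _ C : x y / x * y}.
Proof. exact: rmorphM. Qed.
Lemma f_pi1 : @f_pi _ C 1 = 1.
Proof. exact: rmorph1. Qed.
Lemma f_pi_rel r : f_rel C r -> @f_pi _ C r = 0.
Proof.
move=> Rr; rewrite -(lin0 f_pi_linear); apply/eq_api; rewrite subr0.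
by apply: span_sub; exists 1, r, 1; rewrite mulr1 mul1r.
Qed.

Lemma theta_Serre i j : i != j -> Serre C theta i j = 0.
Proof.
move=> ij; apply: etrans (f_pi_rel (f_Serre C ij)).
exact: esym (Serre_morph C gen i j f_pi_linear f_pi1 f_piM).
Qed.

Let fscale_rel k r : f_rel C r -> free_lift (fun i => scale_at k i *: theta i) r = 0.
Proof.
case=> i j ij.
apply: etrans (Serre_morph _ _ _ _ (free_lift_linear _) (free_lift1 _) (free_liftM _)) _.
have -> : (fun l => free_lift (fun i => scale_at k i *: theta i) (gen l)) =
    (fun l => scale_at k l *: theta l).
  by apply: functional_extensionality_dep => l; exact: free_lift_gen.
by apply: etrans (SerreZ _ _ _ _ _) _; rewrite theta_Serre // scaler0.
Qed.

Lemma fscale_linear k : linear (fscale k).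
Proof. exact: (quo_lift_linear (@fscale_rel k)). Qed.
Lemma fscaleM k : {morph fscale k : x y / x * y}.
Proof. exact: (quo_liftM (@fscale_rel k)). Qed.
Lemma fscale1 k : fscale k 1 = 1.
Proof. exact: (quo_lift1 (@f_proper _ C) (@fscale_rel k)). Qed.
Lemma fscale_theta k i : fscale k (theta i) = scale_at k i *: theta i.
Proof. exact: (quo_lift_gen (@f_proper _ C) (@fscale_rel k)). Qed.

Lemma fscale_hom nu x k : fhom nu x -> fscale k x = v ^+ nu k *: x.
Proof.
move=> Sx; apply: subr0_eq; move: x Sx.
apply: (lin_span0 (h := fun x : f => fscale k x - v ^+ nu k *: x)) => [|_ [w -> ->]].
  exact: linear_sub (fscale_linear k) (linear_scale _).
apply: etrans (congr1 (fun x => x - _)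
  (morph_scaled_word _ (fscale1 k) (fscaleM k) (fscale_theta k))) _.
rewrite ffunE; have -> : \prod_(i <- w) scale_at k i = v ^+ count_mem k w; last exact: subrr.
elim: w => [|i w IH]; first by rewrite big_nil.
by rewrite big_cons IH /= /scale_at; case: eqP => _; rewrite ?mul1r // exprS.
Qed.

Lemma fhom_span nu x : span (@fhom _ C nu) x -> fhom nu x.
Proof. exact: span_sub_span. Qed.

Lemma NI_sep (mu nu : @NI I) : mu <> nu -> exists k, v ^+ mu k <> v ^+ nu k.
Proof.
move=> ne; apply: contrapT => /forallNP h; apply/ne/ffunP => k.
by have /vexpz_inj [] : v ^ (mu k)%:Z = v ^ (nu k)%:Z by apply: contrapT; exact: h.
Qed.

Lemma fhom_basis_span (S : set f) nu x : (forall y, S y -> exists mu, fhom mu y) ->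
  span S x -> fhom nu x -> span (S `&` fhom nu) x.
Proof.
apply: (weight_span fscale_linear (chi := fun k (mu : @NI I) => v ^+ mu k)).
- by move=> mu y k; exact: fscale_hom.
- exact: NI_sep.
- exact: fhom_span.
Qed.

(** Words of content [nu] all have length [NItr nu], so there are finitely many. *)
Lemma fhom_finite nu : exists r : seq f, forall x, fhom nu x -> span [set` r] x.
Proof.
pose word (w : seq I) : f := \prod_(i <- w) theta i.
exists (map (fun t : (NItr nu).-tuple I => word t) (enum {: (NItr nu).-tuple I})) => x.
apply: span_sub_span => _ [w enu ->]; apply: span_sub => /=.
have sw : size w == NItr nu.
  rewrite /NItr enu; apply/eqP; under eq_bigr do rewrite ffunE.
  elim: w {enu} => [|i w IH]; first by rewrite big1.
  rewrite big_split /= -IH (bigD1 i) //= eqxx big1 // => j.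
  by rewrite eq_sym => /negbTE ->.
by apply/mapP; exists (Tuple sw) => //; rewrite mem_enum.
Qed.

End FGrading.

(** * Symmetry of the canonical element and of the diamond product on modules *)

Section QuasiRMatrix.
Context {I : finType} {C : cartan_datum I} {D : root_datum C}.
Local Notation f := (f C).
Local Notation B := (@canonical_basis _ C).
Local Notation X := (Xl D).

Hypothesis canB : is_canonical_basis B.

(** The default value of [fform] is the zero form, which is linear and symmetric too. *)
Lemma fform_linear x : linear (@fform _ C x : f -> Qv^o).
Proof.
have [ex|nex] := pselect (exists! b, @is_fform _ C b).
  by have [h _ _ _ _] := the_spec (fun _ _ => 0) ex; exact: h.
by rewrite /fform (the_default _ nex) => a y z; rewrite scaler0 addr0.
Qed.

Lemma fform_sym (x y : f) : fform x y = fform y x.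
Proof.
have [ex|nex] := pselect (exists! b, @is_fform _ C b).
  by have [_ h _ _ _] := the_spec (fun _ _ => 0) ex; exact: h.
by rewrite /fform (the_default _ nex).
Qed.

Lemma canonical_hom b : B b -> exists nu, fhom nu b.
Proof. by case: canB => _ BS _ _ /BS []. Qed.

Lemma canonical_free nu : free_set (B `&` fhom nu).
Proof.
case: canB => -[_ fB] _ _ _ s c us sB; apply: fB => // b /sB.
by case.
Qed.

Lemma canonical_fin nu : finite_set (B `&` @fhom _ C nu).
Proof.
have [r hr] := @fhom_finite _ C nu.
by apply: (free_set_finite (@canonical_free nu)) => x [_]; exact: hr.
Qed.

(** B spans [f] and consists of homogeneous elements, so those of degree [nu] already span f_nu. *)
Lemma canonical_span nu x : fhom nu x -> span (B `&` @fhom _ C nu) x.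
Proof.
case: canB => -[sB _] _ _ _; exact: fhom_basis_span canonical_hom (sB x).
Qed.

Lemma canonical_element_sym (nu : @NI I) (W : lmodType Qv) (T : f -> f -> W) :
  (forall y, linear (T^~ y)) -> (forall x, linear (T x)) ->
  \sum_(b \in B `&` fhom nu) T b (dual_canonical nu b) =
  \sum_(b \in B `&` fhom nu) T (dual_canonical nu b) b.
Proof.
move=> Tl Tr; have /finite_seqP [s0 Es0] := canonical_fin nu.
pose s := undup s0; have us : uniq s by exact: undup_uniq.
have Es : B `&` @fhom _ C nu = [set` s].
  by rewrite Es0; apply/seteqP; split=> x /=; rewrite mem_undup.
rewrite Es -!fsbig_seq //; apply: (dual_basis_sym (S := @fhom _ C nu) (Q := B)) => //.
- exact: fform_linear.
- exact: fform_sym.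
- by move=> x; exact: fhom_span.
- by move=> x; rewrite -Es; exact: canonical_span.
- move=> x; have -> : (x \in s) = [set` s] x :> Prop by [].
  by rewrite -Es.
- by rewrite -Es; exact: canonical_free.
Qed.

Definition Theta_nu (lam1 lam2 : X) (nu : @NI I) (m1 : oLam lam1) (m2 : Lam lam2) :
    tens (oLam lam1) (Lam lam2) :=
  \sum_(b \in B `&` fhom nu)
    pure (act_oLam (fminus D b) m1) (act_Lam (fplus D (dual_canonical nu b)) m2).

(** On the twisted factor b^- acts as b^+, so both factors involve only [fplus]. The flip merely
    puts b and its dual on the wrong sides, which [canonical_element_sym] repairs. *)
Lemma Theta_nu_swap (lam1 lam2 : X) nu (m1 : Lam lam1) (m2 : Lam lam2) :
  tswap (@Theta_nu lam1 lam2 nu m1 m2) = @Theta_nu lam2 lam1 nu m2 m1.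
Proof.
pose T (x y : f) : tens (Lam lam2) (Lam lam1) :=
  pure (act_Lam (fplus D y) m2) (act_Lam (fplus D x) m1).
have Tl y : linear (T^~ y).
  exact: linear_comp (@pure_linear_r _ _ _ _) (linear_comp (act_Lam_linear_l m1) fplus_linear).
have Tr x : linear (T x).
  exact: linear_comp (@pure_linear_l _ _ _ _) (linear_comp (act_Lam_linear_l m2) fplus_linear).
apply: etrans (etrans _ (canonical_element_sym nu Tl Tr)) _.
  apply: etrans (lin_fsum (@tswap_linear _ _ _) _ _ (can_inj (@tswapK _ _ _))) _.
  apply: eq_fsbigr => b _; apply: etrans (tswap_pure _ _) _.
  by rewrite /T act_oLam_fminus.
by apply: eq_fsbigr => b _; rewrite /T act_oLam_fminus.
Qed.

Lemma is_Psi_swap (lam1 lam2 : X) (P : tens (oLam lam1) (Lam lam2) -> _) :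
  is_Psi P -> @is_Psi _ _ D lam2 lam1 (fun w => tswap (P (tswap w))).
Proof.
case=> PB Pp; split=> [x y|m1 m2].
  apply: etrans (congr1 (fun z => tswap (P z)) (linB (@tswap_linear _ _ _) x y)) _.
  by rewrite PB; exact: linB (@tswap_linear _ _ _) _ _.
rewrite tswap_pure Pp BoLamE.
apply: etrans (lin_fsum (@tswap_linear _ _ _) _ _ (can_inj (@tswapK _ _ _))) _.
apply: eq_fsbigr => nu _; apply: etrans (linZ (@tswap_linear _ _ _) _ _) _.
rewrite BoLamE; congr (_ *: _); exact: Theta_nu_swap.
Qed.

Lemma Psi_swap (lam1 lam2 : X) w :
  Psi (tswap w) = tswap (@Psi _ _ D lam1 lam2 w).
Proof.
(* Conjugation by the flip is the bijection between candidate maps to which [the_transport] is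
   applied. *)
pose g (a b : X) (P : tens (oLam a) (Lam b) -> tens (oLam a) (Lam b)) :
  tens (oLam b) (Lam a) -> tens (oLam b) (Lam a) := fun w => tswap (P (tswap w)).
have gK a b : cancel (g a b) (g b a).
  by move=> P; apply: functional_extensionality_dep => x; rewrite /g !tswapK.
have -> : @Psi _ _ D lam2 lam1 = g lam1 lam2 (@Psi _ _ D lam1 lam2).
  apply/esym; apply: the_transport (gK _ _) (gK _ _) _ _ _ => [P|P|].
  - exact: is_Psi_swap.
  - exact: is_Psi_swap.
  - by apply: functional_extensionality_dep => x; exact: lin0 (@tswap_linear _ _ _).
by rewrite /g tswapK.
Qed.

Lemma vinvZ_comb_swap (lam1 lam2 : X) w :
  @vinvZ_comb _ _ D lam1 lam2 w -> @vinvZ_comb _ _ D lam2 lam1 (tswap w).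
Proof.
case=> s [sP ->]; exists [seq (p.1, (p.2.2, p.2.1)) | p <- s]; split.
  move=> _ /mapP [p ps ->] /=; have [p1 p2 p3] := sP _ ps.
  by split; [exact: p1|rewrite BoLamE; exact: p3|rewrite -BoLamE; exact: p2].
rewrite big_map; apply: etrans (lin_sum (@tswap_linear _ _ _) _ _ _) _.
apply: eq_bigr => p _; apply: etrans (linZ (@tswap_linear _ _ _) _ _) _.
by congr (_ *: _); exact: tswap_pure.
Qed.

Lemma diamond_mod_swap (lam1 lam2 : X) (m1 : Lam lam1) (m2 : Lam lam2) :
  tswap (@diamond_mod _ _ D lam1 lam2 m1 m2) = @diamond_mod _ _ D lam2 lam1 m2 m1.
Proof.
have step (a b : X) (n1 : Lam a) (n2 : Lam b) (w : tens (oLam a) (Lam b)) :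
    Psi w = w /\ vinvZ_comb (w - pure (n1 : oLam a) n2) ->
    Psi (tswap w) = tswap w /\
    @vinvZ_comb _ _ D b a (tswap w - pure n2 n1).
  case=> Pw /vinvZ_comb_swap vw; split; first by rewrite Psi_swap Pw.
  move: vw; rewrite (linB (@tswap_linear _ _ _)).
  by rewrite (tswap_pure n1 n2).
apply: the_transport (@tswapK _ _ _) (@tswapK _ _ _) _ _ _ => [w|w|].
- exact: step.
- exact: step.
- exact: lin0 (@tswap_linear _ _ _).
Qed.
End QuasiRMatrix.

(** * The modified quantum group *)

Section UdotFacts.
Context {I : finType} {C : cartan_datum I} {D : root_datum C}.
Local Notation U := (U D).
Local Notation X := (Xl D).
Local Notation omega := (@omega _ _ D).
Local Notation Udot := (Udot D).
Implicit Types (z : X) (u : U).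

Definition Uz_omega z1 z2 (x : Uz (- z1) (- z2)) : Uz z1 z2 :=
  Uz_pi z1 z2 (omega (qrepr x)).

Lemma UhomB z u u' : Uhom z u -> Uhom z u' -> Uhom z (u - u').
Proof. exact: ahomB. Qed.

Lemma Uz_pi_linear z1 z2 : linear (@Uz_pi _ _ D z1 z2).
Proof. exact: linearP. Qed.

Lemma eq_Uz_pi z1 z2 u u' : Uz_pi z1 z2 u = Uz_pi z1 z2 u' <-> span (Uz_rel z1 z2) (u - u').
Proof. exact: eq_qpi. Qed.

Lemma Uz_reprK z1 z2 (x : Uz z1 z2) : Uz_pi z1 z2 (qrepr x) = x.
Proof. exact: qreprK. Qed.

Lemma Uz_omega_pi z1 z2 u : Uz_omega (Uz_pi (- z1) (- z2) u) = Uz_pi z1 z2 (omega u).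
Proof.
apply/eq_Uz_pi; rewrite -(linB omega_linear) -[z1 in Uz_rel z1]opprK -[z2 in Uz_rel _ z2]opprK.
by apply: Uz_rel_omega; exact: qrepr_qpi.
Qed.

Lemma Uz_omega_linear z1 z2 : linear (@Uz_omega z1 z2).
Proof.
move=> a x y; rewrite -[x in LHS]Uz_reprK -[y in LHS]Uz_reprK.
apply: etrans (congr1 (@Uz_omega z1 z2)
  (esym (@Uz_pi_linear (- z1) (- z2) a (qrepr x) (qrepr y)))) _.
apply: etrans (Uz_omega_pi _ _ _) _; rewrite omega_linear.
exact: Uz_pi_linear.
Qed.

Lemma Uz_omega_eq0 z1 z2 (x : Uz (- z1) (- z2)) : Uz_omega x = 0 -> x = 0.
Proof.
move=> x0; have Sx : span (Uz_rel z1 z2) (omega (qrepr x)).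
  by have /eq_Uz_pi := etrans x0 (esym (lin0 (@Uz_pi_linear z1 z2))); rewrite subr0.
apply: etrans (esym (Uz_reprK x)) (etrans _ (lin0 (@Uz_pi_linear _ _))).
by apply/eq_Uz_pi; rewrite subr0 -[qrepr x]omegaK; exact: Uz_rel_omega.
Qed.

Lemma Uz_omega_inj z1 z2 : injective (@Uz_omega z1 z2).
Proof.
move=> x y xy; apply: subr0_eq; apply: Uz_omega_eq0.
by rewrite (linB (@Uz_omega_linear _ _)) xy subrr.
Qed.

Lemma Uz_omega_neq0 z1 z2 (x : Uz (- z1) (- z2)) : (Uz_omega x != 0) = (x != 0).
Proof.
apply: (congr1 negb); apply/eqP/eqP => [|->]; first exact: Uz_omega_eq0.
exact: lin0 (@Uz_omega_linear _ _).
Qed.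

(** A family [F] avoids a cast: [Uz (- - z1) (- - z2)] and [Uz z1 z2] are distinct types with equal
    indices. *)
Lemma Uz_omegaK (F : forall z1 z2, Uz z1 z2) z1 z2 :
  Uz_omega (Uz_omega (F (- - z1) (- - z2))) = F z1 z2.
Proof.
apply: etrans (Uz_omega_pi _ _ _) _; rewrite omegaK.
have E z z' : z = z1 -> z' = z2 -> Uz_pi z1 z2 (qrepr (F z z')) = F z1 z2.
  by move=> -> ->; exact: Uz_reprK.
by apply: E; rewrite opprK.
Qed.

Definition fam_omega (F : forall z1 z2, Uz z1 z2) z1 z2 : Uz z1 z2 :=
  Uz_omega (F (- z1) (- z2)).

Lemma fin_supp_omega F : fin_supp F -> fin_supp (fam_omega F).
Proof.
move=> finF; apply: sub_finite_set (finite_image (fun z : X * X => (- z.1, - z.2)) finF).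
move=> [z1 z2] Fz; exists (- z1, - z2); last by rewrite /= !opprK.
have {}Fz : Uz_omega (F (- z1) (- z2)) != 0 by exact: Fz.
change (is_true (F (- z1) (- z2) != 0)).
by rewrite -Uz_omega_neq0.
Qed.

Lemma fam_omegaK F : fam_omega (fam_omega F) = F.
Proof. by do 2![apply: functional_extensionality_dep => ?]; exact: Uz_omegaK. Qed.

Lemma Udot_of_comp F z1 z2 : fin_supp F -> Udot_comp (Udot_of F) z1 z2 = F z1 z2.
Proof. by move=> finF; rewrite /Udot_of; case: pselect. Qed.

Lemma Udot_of_default (F : forall z1 z2, Uz z1 z2) : ~ fin_supp F -> Udot_of F = 0.
Proof. by rewrite /Udot_of; case: pselect. Qed.

Lemma Udot_omega_comp (x : Udot) z1 z2 :
  Udot_comp (Udot_omega x) z1 z2 = Uz_omega (Udot_comp x (- z1) (- z2)).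
Proof. by apply: Udot_of_comp; apply: fin_supp_omega; case: x. Qed.

Lemma Udot_omega_supp (x : Udot) z1 z2 :
  Udot_comp (Udot_omega x) z1 z2 != 0 <-> Udot_comp x (- z1) (- z2) != 0.
Proof.
have iffE (a b : bool) : a = b -> a <-> b by move=> ->.
apply: iffE; apply: etrans (congr1 (fun y => y != 0) (Udot_omega_comp x z1 z2)) _.
exact: Uz_omega_neq0.
Qed.

Lemma Udot_comp_lin c (x y : Udot) z1 z2 :
  Udot_comp (c *: x + y) z1 z2 = c *: Udot_comp x z1 z2 + Udot_comp y z1 z2.
Proof. by rewrite Udot_compD; congr (_ + _); exact: addr0. Qed.

Lemma Udot_omega_linear : linear (@Udot_omega _ _ D).
Proof.
move=> c x y; apply: UdotP => z1 z2.
apply: etrans (Udot_omega_comp _ _ _) _.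
apply: etrans (congr1 (@Uz_omega z1 z2) (Udot_comp_lin c x y _ _)) _.
apply: etrans (@Uz_omega_linear z1 z2 c _ _) (esym _).
apply: etrans (Udot_comp_lin _ _ _ _ _) _.
by apply: eq_lincomb; exact: Udot_omega_comp.
Qed.

Lemma Udot_omegaK : involutive (@Udot_omega _ _ D).
Proof.
move=> x; apply: UdotP => z1 z2; apply: etrans (Udot_omega_comp _ _ _) _.
apply: etrans (congr1 (@Uz_omega z1 z2) (Udot_omega_comp _ _ _)) _.
exact: Uz_omegaK (Udot_comp x) z1 z2.
Qed.

(** [fam_omega] is an involution preserving finiteness of support, so both sides take the default 0
    together. *)
Lemma Udot_omega_of F : Udot_omega (Udot_of F) = Udot_of (fam_omega F) :> Udot.
Proof.
have [finF|nfinF] := pselect (fin_supp F).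
  apply: UdotP => z1 z2; apply: etrans (Udot_omega_comp _ _ _) _.
  apply: etrans (congr1 (@Uz_omega z1 z2) (Udot_of_comp _ _ finF)) _.
  exact: esym (Udot_of_comp _ _ (fin_supp_omega finF)).
have nfinO : ~ fin_supp (fam_omega F) by move=> /fin_supp_omega; rewrite fam_omegaK.
apply: etrans (congr1 _ (Udot_of_default nfinF)) _.
exact: etrans (lin0 Udot_omega_linear) (esym (Udot_of_default nfinO)).
Qed.

Lemma Udot_omega_idem u z : Udot_omega (idem u z) = idem (omega u) (- z).
Proof.
apply: etrans (Udot_omega_of _) _; congr Udot_of.
do 2![apply: functional_extensionality_dep => ?]; rewrite /fam_omega eqr_oppLR.
case: eqP => _; first exact: Uz_omega_pi.
exact: lin0 (@Uz_omega_linear _ _).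
Qed.

Lemma Uz_hreprP z1 z2 (x : Uz z1 z2) u : Uhom (z1 - z2) u -> Uz_pi z1 z2 u = x ->
  Uhom (z1 - z2) (Uz_hrepr x) /\ Uz_pi z1 z2 (Uz_hrepr x) = x.
Proof.
move=> hu ux.
apply: (@xgetPex _ 0 [set u | Uhom (z1 - z2) u /\ Uz_pi z1 z2 u = x]).
by exists u.
Qed.

Lemma Uz_hrepr_default z1 z2 (x : Uz z1 z2) :
  (forall u, Uhom (z1 - z2) u -> Uz_pi z1 z2 u <> x) -> Uz_hrepr x = 0.
Proof. by move=> nex; apply: xgetPN => u [hu /(nex _ hu)]. Qed.

(** Replaces the commutation of [omega] with the choice of representatives: the two are homogeneous
    of the same degree and congruent, which is what [zrel_mul] and [act_M_hom0] ask for. *)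
Lemma Uz_hrepr_omega z1 z2 (x : Uz (- z1) (- z2)) :
  [/\ Uhom (z1 - z2) (omega (Uz_hrepr x)), Uhom (z1 - z2) (Uz_hrepr (Uz_omega x)) &
      span (Uz_rel z1 z2) (omega (Uz_hrepr x) - Uz_hrepr (Uz_omega x))].
Proof.
have degE : - (- z1 - - z2) = z1 - z2 by rewrite opprD !opprK.
have Nhom u : Uhom (- z1 - - z2) u -> Uhom (z1 - z2) (omega u).
  by move=> /omega_hom; rewrite degE.
have Nhom' u : Uhom (z1 - z2) u -> Uhom (- z1 - - z2) (omega u).
  by move=> /omega_hom; rewrite -degE opprK.
have hom0 : Uhom (z1 - z2) (0 : U) by move=> mu; rewrite mulr0 mul0r scaler0.
have [[u [hu ux]]|nex] := pselect (exists u, Uhom (- z1 - - z2) u /\ Uz_pi _ _ u = x).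
  have [hx xx] := Uz_hreprP hu ux.
  have [hy yy] : Uhom (z1 - z2) (Uz_hrepr (Uz_omega x)) /\
      Uz_pi z1 z2 (Uz_hrepr (Uz_omega x)) = Uz_omega x.
    apply: (Uz_hreprP (Nhom _ hu)); apply: etrans (esym (Uz_omega_pi _ _ _)) _.
    exact: congr1 ux.
  have e := etrans (esym (Uz_omega_pi _ _ _)) (etrans (congr1 (@Uz_omega z1 z2) xx) (esym yy)).
  exact: And3 (Nhom _ hx) hy (iffLR (eq_Uz_pi _ _ _ _) e).
(* Without a homogeneous representative of [x] there is none of its image either, and both choices
   are the default 0. *)
have -> : Uz_hrepr x = 0.
  by apply: Uz_hrepr_default => u hu ux; apply: nex; exists u.
have -> : Uz_hrepr (Uz_omega x) = 0.
  apply: Uz_hrepr_default => u hu ux; apply: nex.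
  exists (omega u); split; first exact: Nhom'.
  apply: Uz_omega_inj; apply: etrans (Uz_omega_pi _ _ _) _.
  by rewrite omegaK.
by rewrite (lin0 omega_linear) subrr; split=> //; exact: span0.
Qed.

Lemma Udot_omegaM (x y : Udot) :
  Udot_omega (Udot_mul x y) = Udot_mul (Udot_omega x) (Udot_omega y).
Proof.
apply: etrans (Udot_omega_of _) _; congr Udot_of.
apply: functional_extensionality_dep => z1; apply: functional_extensionality_dep => z3.
apply: lin_fsumN => [||z|z _].
- exact: Uz_omega_linear.
- exact: Uz_omega_inj.
- exact: iff_sym (Udot_omega_supp _ _ _).
apply: etrans (Uz_omega_pi _ _ _) _; rewrite omegaM.
have [h1 h2 h3] := Uz_hrepr_omega (Udot_comp x (- z1) (- z)).
apply: etrans (esym (f_equal2 (fun a b => Uz_pi z1 z3 (Uz_hrepr a * qrepr b))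
  (Udot_omega_comp x z1 z) (Udot_omega_comp y z z3))).
have h4 : span (Uz_rel z z3) (omega (qrepr (Udot_comp y (- z) (- z3))) -
    qrepr (Uz_omega (Udot_comp y (- z) (- z3)))).
  by apply: spanBC; exact: qrepr_qpi.
by apply/eq_Uz_pi; exact: (zrel_mul U_relations U_ind h1 h2 h3 h4).
Qed.

Lemma Udot_int_omega x : Udot_int x -> Udot_int (@Udot_omega _ _ D x).
Proof.
elim=> [y [z yE]||c y w cZ _ IHy _ IHw|y w _ IHy _ IHw].
- apply: Zv_gen; exists (- z); case: yE => [->|[i [n [->|->]]]].
  + by left; rewrite Udot_omega_idem omega1.
  + right; exists i, n; right; apply: etrans (Udot_omega_idem _ _) _.
    apply: (congr1 (fun u => idem u (- z))); apply: etrans (omega_dpow _ _) _.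
    by rewrite omegaE.
  + right; exists i, n; left; apply: etrans (Udot_omega_idem _ _) _.
    apply: (congr1 (fun u => idem u (- z))); apply: etrans (omega_dpow _ _) _.
    by rewrite omegaF.
- by rewrite (lin0 Udot_omega_linear); exact: Zv_0.
- exact: (eq_ind_r (@Udot_int _ _ D) (Zv_lin cZ IHy IHw) (Udot_omega_linear c y w)).
- exact: (eq_ind_r (@Udot_int _ _ D) (Zv_mul IHy IHw) (Udot_omegaM y w)).
Qed.

(** After [act_M_swap] the two sides differ only in the homogeneous representative, and the
    difference kills the vector by [act_M_hom0]. *)
Lemma Udot_act_swap (lam1 lam2 : X) (x : Udot) (z : X) : lam1 - lam2 = z ->
  tswap (Udot_act (@act_M _ _ D lam1 lam2) x (- z) (pure (xi lam1) (eta lam2))) =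
  Udot_act (@act_M _ _ D lam2 lam1) (Udot_omega x) z (pure (xi lam2) (eta lam1)).
Proof.
move=> <-; apply: lin_fsumN => [||z1|z1 _].
- exact: tswap_linear.
- exact: can_inj (@tswapK _ _ _).
- exact: iff_sym (Udot_omega_supp _ _ _).
apply: etrans (act_M_swap _ _) _; rewrite Udot_omega_comp.
apply: etrans (congr1 _ (tswap_pure _ _)) _.
have [h1 h2 h3] := Uz_hrepr_omega (Udot_comp x (- z1) (- (lam1 - lam2))).
apply: subr0_eq; apply: etrans (esym (linB (act_M_linear_l _) _ _)) _.
exact: (act_M_hom0 (UhomB h1 h2) h3).
Qed.

(** The predicate inside [diamond], named so that [the_transport] can be instantiated with it. *)
Definition is_diamond (z : X) (b1 b2 : f C) (x : Udot) : Prop :=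
  (exists2 y, Udot_int y & x = Udot_mul y (idem 1 z)) /\
  forall lam1 lam2, dominant lam1 -> dominant lam2 -> lam2 - lam1 = z ->
    let m1 := act_oLam (fplus D b1) (xi lam1) in
    let m2 := act_Lam (fminus D b2) (eta lam2) in
    m1 <> 0 -> m2 <> 0 ->
    Udot_act (@act_M _ _ D lam1 lam2) x z (pure (xi lam1) (eta lam2)) =
      diamond_mod m1 m2.

(** The condition on omega(x) at (lam1, lam2) is the flip of the condition on [x] at (lam2, lam1).
    The nonvanishing hypotheses match because b^+ xi and b^- eta are the same vector. *)
Lemma is_diamond_omega (canB : is_canonical_basis (@canonical_basis _ C)) z b1 b2 x :
  is_diamond z b1 b2 x -> is_diamond (- z) b2 b1 (Udot_omega x).
Proof.
move=> [[y Sy ->] act_y]; split.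
  exists (Udot_omega y); first exact: Udot_int_omega.
  by rewrite Udot_omegaM Udot_omega_idem omega1.
move=> lam1 lam2 d1 d2 lamz m1 m2; rewrite /m1 /m2 => m1N0 m2N0.
have zE : lam1 - lam2 = z by rewrite -opprB lamz opprK.
have := act_y lam2 lam1 d2 d1 zE.
rewrite /= act_oLam_fplus in m1N0 *; rewrite act_oLam_fplus => act_eq.
rewrite -(diamond_mod_swap canB) -(act_eq m2N0 m1N0).
have := Udot_act_swap (Udot_mul y (idem 1 z)) lamz.
by rewrite opprK => ->.
Qed.
End UdotFacts.

Theorem proposition5p2 (I : finType) (C : cartan_datum I) (D : root_datum C)
    (zeta : Xl D) (b1 b2 : f C)
    (hb1 : canonical_basis b1) (hb2 : canonical_basis b2) :
  Udot_omega (diamond zeta b1 b2) = diamond (- zeta) b2 b1.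
Proof.
(* The default value of [canonical_basis] is the empty set, which [hb1] excludes. *)
have canB : is_canonical_basis (@canonical_basis _ C).
  have [ex|nex] := pselect (exists! B, @is_canonical_basis _ C B).
    exact: the_spec ex.
  by move: hb1; rewrite /canonical_basis (the_default _ nex).
apply: (the_transport (P := is_diamond zeta b1 b2) (Q := is_diamond (- zeta) b2 b1)
  (@Udot_omegaK _ _ D) (@Udot_omegaK _ _ D)) => [x|x|].
- exact: is_diamond_omega.
- by move=> /(is_diamond_omega canB); rewrite opprK.
- exact: lin0 (@Udot_omega_linear _ _ D).
Qed.
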